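(* Let $r>0$ and the data $\boldsymbol f$, $M$, $\mathsf F$, $G_i,F_i,H_i,\Xi_i,\Lambda_i,\Gamma_i$ ($i=1,\dots,8$) be as in the context, $\nu=n+p$. If there exist $P\in\mathbb S^\nu$, $Q\in\mathbb R^{\nu\times d\nu}$, $R\in\mathbb S^{d\nu}$, $S,U\in\mathbb S^\nu$, $[K_1\ K_2\ K_3]\in\mathbb R^{p\times(2\nu+d\nu)}$ and $\varkappa_1,\varkappa_2>0$ such that $$\begin{bmatrix}P&Q\\ *&R+I_d\otimes S\end{bmatrix}\succ0,\quad S\succeq0,\quad U\succeq0,\qquad\begin{bmatrix}I&-I-\varkappa_1\mathbf F^\top\mathbf J_2&\varkappa_1\mathbf F^\top\\ *&I-\varkappa_1\mathbf J_3&\mathsf O\\ *&*&\varkappa_1\mathbf J_1\end{bmatrix}\succ0,$$ $$\begin{bmatrix}\boldsymbol\Phi+\mathsf{Sy}[\mathbf P^\top(\mathbf A+\mathbf B\mathbf K)]&\mathbf G+\varkappa_2\mathbf H^\top\mathbf J_2&\varkappa_2\mathbf H^\top\\ *&\varkappa_2\mathbf F^\top\mathbf J_2+\varkappa_2\mathbf J_2^\top\mathbf F+\varkappa_2\mathbf J_3&\varkappa_2\mathbf F^\top\\ *&*&-\varkappa_2\mathbf J_1\end{bmatrix}\prec0,$$ where $\mathbf F=\bigoplus_{i=1}^8F_i$, $\mathbf J_1=\bigoplus_{i=1}^8\Xi_i$, $\mathbf J_2=\bigoplus_{i=1}^8\Lambda_i$, $\mathbf J_3=\bigoplus_{i=1}^8\Gamma_i$,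 $$\mathbf G=\begin{bmatrix}P&\mathsf O_{\nu,m}\\ \mathsf O_\nu&\mathsf O_{\nu,m}\\ Q^\top&\mathsf O_{d\nu,m}\\ \mathsf O_{q,\nu}&-J_2^\top\\ \mathsf O_{m,\nu}&\widetilde J\end{bmatrix}\begin{bmatrix}\mathsf{Row}_{i=1}^4G_i&\mathsf O\\ \mathsf O&\mathsf{Row}_{i=5}^8G_i\end{bmatrix},\qquad\mathbf H=\begin{bmatrix}\bigoplus_{i=1}^4H_i\\ \bigoplus_{i=5}^8H_i\end{bmatrix}\begin{bmatrix}I_{2\nu+d\nu+q}&\mathsf O_{(2\nu+d\nu+q),m}\end{bmatrix},$$ $$\mathbf P=\begin{bmatrix}P&\mathsf O_\nu&Q&\mathsf O_{\nu,q}&\mathsf O_{\nu,m}\end{bmatrix},\quad\mathbf A=\begin{bmatrix}A&\mathsf O_{n,\nu}&B&\mathsf O_{n,d\nu}&D_1&\mathsf O_{n,m}\\ \mathsf O_{p,n}&\mathsf O_{p,\nu}&\mathsf O_p&\mathsf O_{p,d\nu}&D_3&\mathsf O_{p,m}\end{bmatrix},\quad\mathbf B=\begin{bmatrix}\mathsf O_{n,p}\\ I_p\end{bmatrix},\quad\mathbf K=\begin{bmatrix}K_1&K_2&K_3&\mathsf O_{p,(q+m)}\end{bmatrix},$$ $$\boldsymbol\Phi=\mathsf{Sy}\left(\begin{bmatrix}Q\\ \mathsf O_{\nu,d\nu}\\ R\\ \mathsf O_{(q+m),d\nu}\end{bmatrix}\begin{bmatrix}\sqrt{\mathsf F}\boldsymbol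 f(0)\otimes I_\nu&-\sqrt{\mathsf F}\boldsymbol f(-r)\otimes I_\nu&-(\sqrt{\mathsf F}M\sqrt{\mathsf F^{-1}})\otimes I_\nu&\mathsf O_{d\nu,(q+m)}\end{bmatrix}\right)$$ $$+(S+rU)\oplus(-S)\oplus(-I_d\otimes U)\oplus(-J_3)\oplus J_1+\mathsf{Sy}\left(\begin{bmatrix}\mathsf O_{(2\nu+d\nu),m}\\ -J_2^\top\\ \widetilde J\end{bmatrix}\begin{bmatrix}C_1&C_2&C_3&D_2&\mathsf O_m\end{bmatrix}\right),$$ then the uncertain closed-loop system of the context with supply rate function $\mathsf s$ is dissipative, and its origin with $\boldsymbol w(t)\equiv\mathbf 0_q$ is robustly globally asymptotically stable, subject to the uncertainty constraints.
   Context: Notation: $\mathsf{Sy}(X)=X+X^\top$; $\mathsf{Row}_iX_i$ concatenates horizontally; $\oplus$ is block-diagonal sum; $\otimes$ Kronecker product; $\mathbb S^n$ = real symmetric $n\times n$ matrices; $\mathsf O_{n,m}$ zero matrix, $\mathsf O_n=\mathsf O_{n,n}$; unlabelled $I,\mathsf O$ have compatible sizes; $*$ denotes blocks determined by symmetry; $\sqrt X$ is the unique positive definite square root of $X\succ0$. Functions: $\boldsymbol f\in C^1(\mathbb R;\mathbb R^d)$ with $\mathsf F^{-1}=\int_{-r}^0\boldsymbol f\boldsymbol f^\top d\tau\succ0$, $\boldsymbol f'(\tau)=M\boldsymbol f(\tau)$ for some $M\in\mathbb R^{d\times d}$, and there exist $K\in\mathbb R^{p\times n}$, $X\in\mathbb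 R^{p\times p}$, $\widehat K$ with $[\mathsf O_{p,n}\ \ (KA-XK)e^{-A\tau}B]=\widehat K(\sqrt{\mathsf F}\boldsymbol f(\tau)\otimes I_\nu)$. System: nominal $A\in\mathbb R^{n\times n}$, $B\in\mathbb R^{n\times p}$ such that $A+BK$ is Hurwitz for some $K$. A linear plant $\dot{\boldsymbol x}(t)=\grave A\boldsymbol x(t)+\grave B\boldsymbol u(t-r)+\grave D_1\boldsymbol w(t)$ in $\mathbb R^n$ is controlled by the dynamical state feedback $\dot{\boldsymbol u}(t)=\grave K_1\boldsymbol\eta(t)+\grave K_2\boldsymbol\eta(t-r)+\int_{-r}^0\grave K_3(\sqrt{\mathsf F}\boldsymbol f(\tau)\otimes I_\nu)\boldsymbol\eta(t+\tau)d\tau+\grave D_3\boldsymbol w(t)$, $\boldsymbol\eta=\begin{bmatrix}\boldsymbol x\\ \boldsymbol u\end{bmatrix}\in\mathbb R^\nu$, all with uncertainties. The resulting uncertain closed-loop system is, for $t\ge t_0$, $$\dot{\boldsymbol\eta}(t)=\left(\left[\begin{bmatrix}A\ \ \mathsf O_{n,p}\\ K_1\end{bmatrix}\ \begin{bmatrix}\mathsf O_n\ \ B\\ K_2\end{bmatrix}\ \begin{bmatrix}\mathsf O_{n,d\nu}\\ K_3\end{bmatrix}\ \begin{bmatrix}D_1\\ D_3\end{bmatrix}\right]+\mathsf{Row}_{i=1}^4G_i(I-\Delta_iF_i)^{-1}\Delta_iH_i\right)\boldsymbol\vartheta(t),$$ $$\boldsymbol z(t)=\left([C_1\ C_2\ C_3\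 D_2]+\mathsf{Row}_{i=5}^8G_i(I-\Delta_iF_i)^{-1}\Delta_iH_i\right)\boldsymbol\vartheta(t),$$ with continuous initial function for $\boldsymbol\eta$ on $[t_0-r,t_0]$, where $\boldsymbol\vartheta(t)$ stacks $\boldsymbol\eta(t)$, $\boldsymbol\eta(t-r)$, $\int_{-r}^0(\sqrt{\mathsf F}\boldsymbol f(\tau)\otimes I_\nu)\boldsymbol\eta(t+\tau)d\tau$, $\boldsymbol w(t)$; $\boldsymbol w\in\mathcal L^2([t_0,\infty);\mathbb R^q)$, $\boldsymbol z(t)\in\mathbb R^m$; $C_1,C_2\in\mathbb R^{m\times\nu}$, $C_3\in\mathbb R^{m\times d\nu}$, $D_1\in\mathbb R^{n\times q}$, $D_2\in\mathbb R^{m\times q}$, $D_3\in\mathbb R^{p\times q}$ given. Uncertainty constraints: for $i=1,\dots,8$, $\begin{bmatrix}I\\ \Delta_i\end{bmatrix}^\top\begin{bmatrix}\Xi_i^{-1}&\Lambda_i\\ *&\Gamma_i\end{bmatrix}\begin{bmatrix}I\\ \Delta_i\end{bmatrix}\succeq0$ with given $\Xi_i\succ0$, $\Gamma_i\preceq0$, $\Lambda_i$; ''subject to the uncertainty constraints'' means for all such $\Delta_i$ (inverses being well defined). Supply rate: $\mathsf s(\boldsymbol z,\boldsymbol w)=\begin{bmatrix}\boldsymbol z\\ \boldsymbol w\end{bmatrix}^\top\begin{bmatrix}\widetilde J^\top J_1^{-1}\widetilde J&J_2\\ *&J_3\end{bmatrix}\begin{bmatrix}\boldsymbol z\\ \boldsymbol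 w\end{bmatrix}$, $J_1\in\mathbb S^m$, $J_1^{-1}\prec0$, $\widetilde J\in\mathbb R^{m\times m}$, $J_2\in\mathbb R^{m\times q}$, $J_3\in\mathbb S^q$. Dissipative: there is a differentiable $\mathsf v:C([-r,0];\mathbb R^\nu)\to\mathbb R_{\ge0}$ with $\frac d{dt}\mathsf v(\boldsymbol\eta_t(\cdot))-\mathsf s(\boldsymbol z(t),\boldsymbol w(t))\le0$ for all $t\ge t_0$, $\boldsymbol\eta_t(\theta)=\boldsymbol\eta(t+\theta)$. *)

(* Defs.v *)
(* [mxtens] provides the Kronecker product [*t]. *)
From HB Require Import structures.
From mathcomp Require Import all_boot all_order all_algebra.
From mathcomp Require Import all_classical all_reals all_analysis.
From mathcomp.real_closed Require Export complex mxtens.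
Set Implicit Arguments.
Unset Strict Implicit.
Unset Printing Implicit Defensive.
Import Order.TTheory GRing.Theory Num.Theory.
Import numFieldNormedType.Exports.
Local Open Scope classical_set_scope.
Local Open Scope ring_scope.

Section MatrixNotions.
Context {R : realType}.

Definition Sy k (X : 'M[R]_k) : 'M[R]_k := X + X^T.

Definition posdefmx k (X : 'M[R]_k) : Prop :=
  X^T = X /\ forall x : 'cV[R]_k, x != 0 -> 0 < (x^T *m X *m x) 0 0.

Definition possemidefmx k (X : 'M[R]_k) : Prop :=
  X^T = X /\ forall x : 'cV[R]_k, 0 <= (x^T *m X *m x) 0 0.

Definition negdefmx k (X : 'M[R]_k) : Prop := posdefmx (- X).

Definition negsemidefmx k (X : 'M[R]_k) : Prop := possemidefmx (- X).

(* The positive definite square root of a positive definite matrix (a junk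
   value on other arguments). *)
Definition sqrtmx k (X : 'M[R]_k) : 'M[R]_k :=
  xget 0 [set Y | posdefmx Y /\ Y *m Y = X].

Definition expmx k (X : 'M[R]_k) : 'M[R]_k :=
  \matrix_(i, j) limn (series (fun N => (X ^+ N) i j / N`!%:R)).

Definition hurwitz k (X : 'M[R]_k) : Prop :=
  forall z : R[i], eigenvalue (map_mx (real_complex R) X) z ->
    complex.Re z < 0.

Definition row4 k n1 n2 n3 n4 (X1 : 'M[R]_(k, n1)) (X2 : 'M[R]_(k, n2))
    (X3 : 'M[R]_(k, n3)) (X4 : 'M[R]_(k, n4)) :
    'M[R]_(k, n1 + (n2 + (n3 + n4))) :=
  row_mx X1 (row_mx X2 (row_mx X3 X4)).

Definition col4 k m1 m2 m3 m4 (X1 : 'M[R]_(m1, k)) (X2 : 'M[R]_(m2, k))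
    (X3 : 'M[R]_(m3, k)) (X4 : 'M[R]_(m4, k)) :
    'M[R]_(m1 + (m2 + (m3 + m4)), k) :=
  col_mx X1 (col_mx X2 (col_mx X3 X4)).

Definition dsum m1 m2 n1 n2 (X1 : 'M[R]_(m1, n1)) (X2 : 'M[R]_(m2, n2)) :
    'M[R]_(m1 + m2, n1 + n2) :=
  block_mx X1 0 0 X2.

Definition dsum4 m1 m2 m3 m4 n1 n2 n3 n4 (X1 : 'M[R]_(m1, n1))
    (X2 : 'M[R]_(m2, n2)) (X3 : 'M[R]_(m3, n3)) (X4 : 'M[R]_(m4, n4)) :
    'M[R]_(m1 + (m2 + (m3 + m4)), n1 + (n2 + (n3 + n4))) :=
  dsum X1 (dsum X2 (dsum X3 X4)).

(* The blocks below the diagonal are the transposes of those above it. *)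
Definition symblock2 k1 k2 (X11 : 'M[R]_k1) (X12 : 'M[R]_(k1, k2))
    (X22 : 'M[R]_k2) : 'M[R]_(k1 + k2) :=
  block_mx X11 X12 X12^T X22.

Definition symblock3 k1 k2 k3 (X11 : 'M[R]_k1) (X12 : 'M[R]_(k1, k2))
    (X13 : 'M[R]_(k1, k3)) (X22 : 'M[R]_k2) (X23 : 'M[R]_(k2, k3))
    (X33 : 'M[R]_k3) : 'M[R]_(k1 + (k2 + k3)) :=
  symblock2 X11 (row_mx X12 X13) (symblock2 X22 X23 X33).

(* x (x) I_k for a column vector x; the cast only turns 1 * k into k. *)
Definition kronI d k (x : 'cV[R]_d) : 'M[R]_(d * k, k) :=
  castmx (erefl _, mul1n k) (x *t (1%:M : 'M[R]_k)).

Definition mxint k l (a b : R) (X : R -> 'M[R]_(k, l)) : 'M[R]_(k, l) :=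
  \matrix_(i, j) (\int[lebesgue_measure]_(s in `[a, b]) X s i j).

End MatrixNotions.

(* One linear fractional uncertainty G (I - Delta F)^-1 Delta H, with
   k x l the size of the block it perturbs and Delta of size [cb] x [ca]. *)
Record channel (R : realType) (k l : nat) := Channel {
  ca : nat;
  cb : nat;
  cG : 'M[R]_(k, cb);
  cF : 'M[R]_(ca, cb);
  cH : 'M[R]_(ca, l);
  cXi : 'M[R]_ca;
  cLam : 'M[R]_(ca, cb);
  cGam : 'M[R]_cb;
  cXi_pos : posdefmx cXi;
  cGam_neg : negsemidefmx cGam }.

Section Uncertainty.
Context {R : realType}.

Definition admissible k l (c : channel R k l) : set 'M[R]_(cb c, ca c) :=
  [set De | let S := col_mx (1%:M : 'M[R]_(ca c)) De in
    possemidefmx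
      (S^T *m symblock2 (invmx (cXi c)) (cLam c) (cGam c) *m S)].
Arguments admissible {k l} c _.

Definition well_posed k l (c : channel R k l) : Prop :=
  forall De, admissible c De -> (1%:M - De *m cF c) \in unitmx.

Definition perturbation k l (c : channel R k l) (De : 'M[R]_(cb c, ca c)) :
    'M[R]_(k, l) :=
  cG c *m invmx (1%:M - De *m cF c) *m De *m cH c.
Arguments perturbation {k l} c De.

(* An uncertain system is represented by the set of all the pairs (E, C) of
   coefficient matrices (eta' = E theta, z = C theta) that it can realize. *)
Definition uncertain_system nu m h1 h2 h3 h4
    (E0 : 'M[R]_(nu, h1 + (h2 + (h3 + h4))))
    (C0 : 'M[R]_(m, h1 + (h2 + (h3 + h4))))
    (c1 : channel R nu h1) (c2 : channel R nu h2)
    (c3 : channel R nu h3) (c4 : channel R nu h4)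
    (c5 : channel R m h1) (c6 : channel R m h2)
    (c7 : channel R m h3) (c8 : channel R m h4) :
    set ('M[R]_(nu, h1 + (h2 + (h3 + h4))) *
         'M[R]_(m, h1 + (h2 + (h3 + h4)))) :=
  [set EC | exists De1 De2 De3 De4 De5 De6 De7 De8,
    [/\ admissible c1 De1, admissible c2 De2,
        admissible c3 De3 & admissible c4 De4] /\
    [/\ admissible c5 De5, admissible c6 De6,
        admissible c7 De7 & admissible c8 De8] /\
    EC = (E0 + row4 (perturbation c1 De1) (perturbation c2 De2)
                    (perturbation c3 De3) (perturbation c4 De4),
          C0 + row4 (perturbation c5 De5) (perturbation c6 De6)
                    (perturbation c7 De7) (perturbation c8 De8))].

End Uncertainty.

Section DelaySystems.
Context {R : realType}.
Context (r : R) (nu : nat).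

(* C([-r, 0]; R^nu): a total function stands for its restriction to [-r, 0];
   every notion below depends on that restriction only. *)
Definition history : set (R -> 'cV[R]_nu) :=
  [set phi | {within `[- r, 0], continuous phi}].

Definition segment (eta : R -> 'cV[R]_nu) (t : R) : R -> 'cV[R]_nu :=
  fun th => eta (t + th).

Definition supnorm (phi : R -> 'cV[R]_nu) : R :=
  sup [set `|phi th| | th in `[- r, 0]].

(* Frechet differentiability on (C([-r, 0]; R^nu), sup norm). *)
Definition functional_differentiable (v : (R -> 'cV[R]_nu) -> R) : Prop :=
  forall phi, history phi -> exists L : (R -> 'cV[R]_nu) -> R,
    [/\ forall (a : R) g h, history g -> history h ->
          L (fun th => a *: g th + h th) = a * L g + L h,
        exists c : R, forall h, history h -> `|L h| <= c * supnorm h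
      & forall e : R, 0 < e -> exists2 de : R, 0 < de &
          forall h, history h -> supnorm h <= de ->
            `|v (fun th => phi th + h th) - v phi - L h| <= e * supnorm h].

(* Derivative at t >= t0 of a function on [t0, +oo[: the usual derivative if
   t > t0, the right derivative if t = t0. *)
Definition has_deriv_from (V : normedModType R) (t0 : R) (y : R -> V) (t : R)
    (l : V) : Prop :=
  (s - t)^-1 *: (y s - y t) @[s --> within `[t0, +oo[ (dnbhs t)] --> l.

Definition L2_from q (t0 : R) (w : R -> 'cV[R]_q) : Prop :=
  forall i, measurable_fun `[t0, +oo[ (fun t => w t i 0) /\
    (\int[lebesgue_measure]_(t in `[t0, +oo[) ((w t i 0) ^+ 2)%:E < +oo)%E.

Context (l q m : nat) (ker : R -> 'M[R]_(l, nu)).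
Local Notation width := (nu + (nu + (l + q)))%N.

(* theta(t) = (eta(t), eta(t - r), int_{-r}^0 ker(s) eta(t + s) ds, w(t)) *)
Definition theta (eta : R -> 'cV[R]_nu) (w : R -> 'cV[R]_q) (t : R) :
    'cV[R]_width :=
  col4 (eta t) (eta (t - r))
       (mxint (- r) 0 (fun s => ker s *m eta (t + s))) (w t).

Definition state_equation_at (E : 'M[R]_(nu, width)) (t0 : R)
    (w : R -> 'cV[R]_q) (eta : R -> 'cV[R]_nu) (t : R) : Prop :=
  has_deriv_from t0 eta t (E *m theta eta w t).

(* Caratheodory solutions, in integral form: since w is only in L^2, the
   equation holds at almost every t >= t0. *)
Definition solution (E : 'M[R]_(nu, width)) (t0 : R)
    (w : R -> 'cV[R]_q) (eta : R -> 'cV[R]_nu) : Prop :=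
  {within `[t0 - r, +oo[, continuous eta} /\
  forall t, t0 <= t ->
    eta t = eta t0 + mxint t0 t (fun s => E *m theta eta w s).

(* "For all t >= t0" is read accordingly: the inequality holds at every t at
   which the state equation does (hence everywhere along a classical
   solution), and at almost every t in any case. *)
Definition dissipative
    (sys : set ('M[R]_(nu, width) * 'M[R]_(m, width)))
    (supply : 'cV[R]_m -> 'cV[R]_q -> R) : Prop :=
  exists v : (R -> 'cV[R]_nu) -> R,
    [/\ functional_differentiable v,
        forall phi, history phi -> 0 <= v phi
      & forall E C, sys (E, C) ->
        forall (t0 : R) w eta, L2_from t0 w -> solution E t0 w eta ->
          let dissipates_at t := exists2 dv : R,
            has_deriv_from t0 (fun s => v (segment eta s) : R^o) t dv &
            dv - supply (C *m theta eta w t) (w t) <= 0 in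
          (forall t, t0 <= t -> state_equation_at E t0 w eta t ->
             dissipates_at t) /\
          {ae lebesgue_measure, forall t : R, t0 <= t -> dissipates_at t}].

Definition robustly_gas
    (sys : set ('M[R]_(nu, width) * 'M[R]_(m, width))) : Prop :=
  forall E C, sys (E, C) -> forall t0 : R,
    let free_solution := solution E t0 (fun=> 0) in
    (forall e : R, 0 < e -> exists2 de : R, 0 < de &
       forall eta, free_solution eta -> supnorm (segment eta t0) < de ->
         forall t, t0 <= t -> `|eta t| < e) /\
    (forall eta, free_solution eta -> eta t @[t --> +oo] --> (0 : 'cV[R]_nu)).

End DelaySystems.

Arguments dissipative {R} r {nu l q m} ker sys supply.
Arguments robustly_gas {R} r {nu l q m} ker sys.

Definition supply_rate (R : realType) m q (Jt J1 : 'M[R]_m)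
    (J2 : 'M[R]_(m, q)) (J3 : 'M[R]_q) (z : 'cV[R]_m) (w : 'cV[R]_q) : R :=
  ((col_mx z w)^T *m symblock2 (Jt^T *m invmx J1 *m Jt) J2 J3 *m
   col_mx z w) 0 0.

(* Main.v *)
Require Import Defs.
From HB Require Import structures.
From mathcomp Require Import all_boot all_order all_algebra.
From mathcomp Require Import all_classical all_reals all_analysis.
From mathcomp Require Import measurable_realfun ring lra.
Set Implicit Arguments.
Unset Strict Implicit.
Unset Printing Implicit Defensive.
Import Order.TTheory GRing.Theory Num.Theory.
Import numFieldNormedType.Exports.
Local Open Scope classical_set_scope.
Local Open Scope ring_scope.

(** The certificate is the quadratic functional
      v(phi) = [phi(0); z]^T [P Q; Q^T R] [phi(0); z]
               + int_{-r}^0 phi(s)^T (S + (s + r) U) phi(s) ds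
    of a history phi, where z = int_{-r}^0 ker(s) phi(s) ds collects the moments
    of phi along ker(s) = sqrt(F) f(s) (x) I.

    The factor sqrt(F) makes the components of sqrt(F) f orthonormal on
    [-r, 0]. Bessel's inequality (bessel_form) then gives
      z^T (I (x) S) z <= int phi^T S phi,
    and the same for U. Applied to S, it makes v bounded below by a multiple of
    |phi(0)|^2 as soon as [P Q; Q^T R + I (x) S] is positive definite
    (lk_functional_coercive). Since f' = M f, the derivative of ker is N ker
    with a constant matrix N; therefore the derivative of z along a trajectory
    is a linear function of eta(t), eta(t - r) and z, whatever the continuous
    trajectory (memory_derive). The derivative of v is then a quadratic form in
    theta(t) and eta'(t) minus int eta^T U eta, and Bessel's inequality for U
    bounds it by a quadratic form in theta(t) alone.

    It remains to see that the matrix inequality says that this form, minus the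
    supply rate, is negative (lmi_dissipation). Two devices are used. The term
    of the supply rate that is quadratic in the output is nonpositive; its
    opposite is the maximum over an auxiliary vector y of an expression linear
    in the output; this is the last block of the matrix Phi. The
    uncertainties are removed by the S-procedure: each perturbation
    G (I - De F)^-1 De H th equals G a where a = De (H th + F a), and the pair
    (H th + F a, a) satisfies the quadratic inequality which defines the
    admissible De, so it may be added with the weight k2. The same test with
    H = 0 and the first matrix inequality shows that I - De F has no kernel
    (strict_well_posed).

    For dissipativity the disturbance is only square integrable and a solution
    is an integral equation; by Lebesgue's differentiation theorem it satisfies
    the state equation at almost every time (ae_state_equation), and at any such
    time v has the expected derivative because its other ingredients are
    differentiable at every time (distributed_delay_derive). Without disturbance
    the state equation holds at all times and v' <= - e |eta|^2: stability
    follows from the two-sided bounds on v, and convergence from the fact that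
    |eta|^2 has a bounded derivative while v converges (lyapunov_decay). *)

(** * Inner products, norms and limits of matrices *)

Section InnerProduct.
Context {R : realType}.

Definition dot k (u v : 'cV[R]_k) : R := (u^T *m v) 0 0.

Lemma dotE k (u v : 'cV[R]_k) : dot u v = \sum_i u i 0 * v i 0.
Proof. by rewrite /dot mxE; apply: eq_bigr => i _; rewrite mxE. Qed.

Lemma dotC k (u v : 'cV[R]_k) : dot u v = dot v u.
Proof. by rewrite !dotE; apply: eq_bigr => i _; rewrite mulrC. Qed.

Lemma dotDl k (u v w : 'cV[R]_k) : dot (u + v) w = dot u w + dot v w.
Proof. by rewrite /dot linearD mulmxDl mxE. Qed.

Lemma dotDr k (u v w : 'cV[R]_k) : dot w (u + v) = dot w u + dot w v.
Proof. by rewrite /dot mulmxDr mxE. Qed.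

Lemma dotNl k (u w : 'cV[R]_k) : dot (- u) w = - dot u w.
Proof. by rewrite /dot linearN mulNmx mxE. Qed.

Lemma dotNr k (u w : 'cV[R]_k) : dot w (- u) = - dot w u.
Proof. by rewrite /dot mulmxN mxE. Qed.

Lemma dotZl k a (u w : 'cV[R]_k) : dot (a *: u) w = a * dot u w.
Proof. by rewrite /dot linearZ -scalemxAl mxE. Qed.

Lemma dotZr k a (u w : 'cV[R]_k) : dot w (a *: u) = a * dot w u.
Proof. by rewrite /dot -scalemxAr mxE. Qed.

Lemma dot0l k (w : 'cV[R]_k) : dot 0 w = 0.
Proof. by rewrite /dot trmx0 mul0mx mxE. Qed.

Lemma dot0r k (w : 'cV[R]_k) : dot w 0 = 0.
Proof. by rewrite /dot mulmx0 mxE. Qed.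

Lemma dot_trmx k l (X : 'M[R]_(k, l)) u v : dot u (X^T *m v) = dot (X *m u) v.
Proof. by rewrite /dot trmx_mul mulmxA. Qed.

Lemma dot_sym k (X : 'M[R]_k) u v : X^T = X -> dot u (X *m v) = dot v (X *m u).
Proof. by move=> sX; rewrite -{1}sX dot_trmx dotC. Qed.

Lemma dot_col k l (u v : 'cV[R]_k) (u' v' : 'cV[R]_l) :
  dot (col_mx u u') (col_mx v v') = dot u v + dot u' v'.
Proof. by rewrite /dot tr_col_mx mul_row_col mxE. Qed.

Lemma quadE k (X : 'M[R]_k) x : (x^T *m X *m x) 0 0 = dot x (X *m x).
Proof. by rewrite /dot mulmxA. Qed.

Lemma dot_ge0 k (u : 'cV[R]_k) : 0 <= dot u u.
Proof. by rewrite dotE; apply: sumr_ge0 => i _; rewrite -expr2 sqr_ge0. Qed.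

Lemma coord_le_norm k l (X : 'M[R]_(k, l)) i j : `|X i j| <= `|X|.
Proof.
by rewrite [leRHS]/Num.norm /= mx_normrE (le_bigmax _ (fun ij => `|X ij.1
  ij.2|) (i, j)).
Qed.

Lemma norm_le_coord k l (X : 'M[R]_(k, l)) e :
  0 <= e -> (forall i j, `|X i j| <= e) -> `|X| <= e.
Proof.
by move=> e0 Xe; rewrite /Num.norm /= mx_normrE bigmax_le// => -[i j] _ /=.
Qed.

Lemma norm_trmx k l (X : 'M[R]_(k, l)) : `|X^T| = `|X|.
Proof.
have le_tr a b (Y : 'M[R]_(a, b)) : `|Y^T| <= `|Y|.
  by apply: norm_le_coord => // i j; rewrite mxE coord_le_norm.
by apply/eqP; rewrite eq_le le_tr -{1}[X]trmxK le_tr.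
Qed.

Lemma natmul_sum k (a : R) : k%:R * a = \sum_(i < k) a.
Proof. by rewrite sumr_const card_ord mulr_natl. Qed.

Lemma norm_dot_le k (u v : 'cV[R]_k) : `|dot u v| <= k%:R * (`|u| * `|v|).
Proof.
rewrite dotE (le_trans (ler_norm_sum _ _ _))//.
rewrite natmul_sum.
by apply: ler_sum => i _; rewrite normrM ler_pM// coord_le_norm.
Qed.

Lemma sqr_norm_le_dot k (u : 'cV[R]_k) : `|u| ^+ 2 <= dot u u.
Proof.
have [/eqP ->|u0] := boolP (u == 0); first by rewrite normr0 expr0n dot0l.
have [[i j] /= ui] : exists i, `|u| = `|u i.1 i.2|.
  by apply: mx_norm_neq0; rewrite -[mx_norm u]/(`|u|) normr_eq0.
rewrite ui ord1 real_normK ?num_real// dotE (bigD1 i)//= -expr2 lerDl.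
by apply: sumr_ge0 => l _; rewrite -expr2 sqr_ge0.
Qed.

Lemma norm_mulmx_le k l (X : 'M[R]_(k, l)) (u : 'cV[R]_l) :
  `|X *m u| <= (l%:R * `|X|) * `|u|.
Proof.
apply: norm_le_coord => [|i j]; first by rewrite !mulr_ge0.
rewrite mxE (le_trans (ler_norm_sum _ _ _))//.
rewrite -mulrA natmul_sum.
by apply: ler_sum => a _; rewrite normrM ler_pM// coord_le_norm.
Qed.

Lemma cvg_sumr T (F : set_system T) {FF : Filter F} n (f : 'I_n -> T -> R) l :
  (forall i, f i x @[x --> F] --> l i) ->
  \sum_i f i x @[x --> F] --> \sum_i l i.
Proof.
elim: n f l => [f l _|n IHn f l fl].
  by rewrite big_ord0; under eq_fun do rewrite big_ord0; exact: cvg_cst.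
rewrite big_ord_recr; under eq_fun do rewrite big_ord_recr.
by apply: cvgD => //; apply: IHn => i; exact: fl.
Qed.

Lemma cvg_mx T (F : set_system T) {FF : Filter F} k l
    (X : T -> 'M[R]_(k, l)) (L : 'M[R]_(k, l)) :
  (forall i j, X x i j @[x --> F] --> L i j) -> X x @[x --> F] --> L.
Proof.
move=> XL; apply/cvgrPdist_le => e e0.
have : \forall x \near F, forall ij, `|L ij.1 ij.2 - X x ij.1 ij.2| <= e.
  by apply: filter_forall => -[i j] /=;
    move/cvgrPdist_le: (XL i j) => /(_ e e0).
apply: filterS => x Lx; apply: norm_le_coord => [|i j]; first exact: ltW.
by rewrite !mxE (Lx (i, j)).
Qed.

Lemma cvg_coord T (F : set_system T) {FF : Filter F} k l
    (X : T -> 'M[R]_(k, l)) (L : 'M[R]_(k, l)) i j :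
  X x @[x --> F] --> L -> X x i j @[x --> F] --> L i j.
Proof. by move=> XL; exact: (cvg_comp X _ XL (@coord_continuous _ _ _ i j L)).
  Qed.

Lemma cvg_mulmx T (F : set_system T) {FF : Filter F} k l p
    (X : T -> 'M[R]_(k, l)) (Y : T -> 'M[R]_(l, p))
    (LX : 'M[R]_(k, l)) (LY : 'M[R]_(l, p)) :
  X x @[x --> F] --> LX -> Y x @[x --> F] --> LY ->
  X x *m Y x @[x --> F] --> LX *m LY.
Proof.
move=> XL YL; apply: cvg_mx => i j; rewrite mxE; under eq_fun do rewrite mxE.
by apply: cvg_sumr => a; apply: cvgM; exact: cvg_coord.
Qed.

Lemma cvg_trmx T (F : set_system T) {FF : Filter F} k l
    (X : T -> 'M[R]_(k, l)) (LX : 'M[R]_(k, l)) :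
  X x @[x --> F] --> LX -> (X x)^T @[x --> F] --> LX^T.
Proof.
move=> XL; apply: cvg_mx => i j; rewrite mxE; under eq_fun do rewrite mxE.
exact: cvg_coord.
Qed.

Lemma cvg_dot T (F : set_system T) {FF : Filter F} k
    (X Y : T -> 'cV[R]_k) (LX LY : 'cV[R]_k) :
  X x @[x --> F] --> LX -> Y x @[x --> F] --> LY ->
  dot (X x) (Y x) @[x --> F] --> dot LX LY.
Proof.
by move=> XL YL; apply: cvg_coord; apply: cvg_mulmx YL; exact: cvg_trmx.
Qed.

(** The form attains a positive minimum on the unit sphere of the maximum
    norm, which is compact; homogeneity does the rest. *)
Lemma posdef_coercive k (X : 'M[R]_k) : posdefmx X ->
  exists2 e, 0 < e & forall x, e * `|x| ^+ 2 <= dot x (X *m x).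
Proof.
move=> [_ Xpos]; pose f (x : 'rV[R]_k) := dot x^T (X *m x^T).
have cf : continuous f.
  have -> : f = fun x => \sum_i x 0 i * \sum_j X i j * x 0 j.
    apply/funext => x; rewrite /f dotE; apply: eq_bigr => i _.
    by rewrite !mxE; congr (_ * _); apply: eq_bigr => j _; rewrite mxE.
  move=> x; apply: (@cvg_sumr _ (nbhs x)) => i; apply: cvgM.
    exact: coord_continuous.
  by apply: (@cvg_sumr _ (nbhs x)) => j; apply: cvgM;
    [exact: cvg_cst|exact: coord_continuous].
pose A := [set x : 'rV[R]_k | `|x| = 1].
have [A0|/set0P An0] := eqVneq A set0.
  exists 1 => // x; have [->|x0] := eqVneq x 0.
    by rewrite normr0 expr0n mulr0 dot0l.
  have : A (`|x|^-1 *: x^T).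
    by rewrite /A /= normrZ norm_trmx normfV normr_id mulVf// normr_eq0.
  by rewrite A0.
have cA : compact A.
  apply: bounded_closed_compact.
    by exists 1; split => [|y y1 x /= ->]; [exact: num_real|exact: ltW].
  have -> : A = (@Num.norm _ 'rV[R]_k) @^-1` [set 1] by [].
  apply: closed_comp; last exact: closed_eq.
  by move=> x _; exact: norm_continuous.
have [c /set_mem cA1 cmin] := EVT_min_rV An0 cA (continuous_subspaceT cf).
have fc0 : 0 < f c.
  rewrite /f -quadE Xpos//; apply: contraPneq cA1 => /(congr1 trmx).
  rewrite trmxK trmx0 => ->; rewrite /A /= normr0 => /esym/eqP.
  by rewrite oner_eq0.
exists (f c) => // x; have [->|x0] := eqVneq x 0.
  by rewrite normr0 expr0n mulr0 dot0l.
have nx : `|x| != 0 by rewrite normr_eq0.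
have /mem_set/cmin : A (`|x|^-1 *: x^T).
  by rewrite /A /= normrZ norm_trmx normfV normr_id mulVf.
rewrite {2}/f linearZ /= trmxK -scalemxAr dotZl dotZr mulrA -expr2 exprVn.
by rewrite mulrC ler_pdivlMr// exprn_gt0// lt0r nx /=.
Qed.

End InnerProduct.

(** * Uncertain channels and their multiplier forms *)

Section MultiplierForm.
Context {R : realType}.

Lemma dsum_col m1 m2 n1 n2 (X : 'M[R]_(m1, n1)) (Y : 'M[R]_(m2, n2))
    (u : 'cV[R]_n1) (v : 'cV[R]_n2) :
  dsum X Y *m col_mx u v = col_mx (X *m u) (Y *m v).
Proof. by rewrite /dsum mul_block_col !mul0mx addr0 add0r. Qed.

Lemma symblock2_form k1 k2 (X : 'M[R]_k1) (Y : 'M[R]_(k1, k2)) Z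
    (u : 'cV[R]_k1) (v : 'cV[R]_k2) :
  dot (col_mx u v) (symblock2 X Y Z *m col_mx u v) =
  dot u (X *m u) + 2 * dot u (Y *m v) + dot v (Z *m v).
Proof.
rewrite /symblock2 mul_block_col dot_col !dotDr dot_trmx.
by rewrite (dotC (Y *m v)); ring.
Qed.

Lemma symblock3_form k1 k2 k3 (X1 : 'M[R]_k1) (X2 : 'M[R]_(k1, k2))
    (X3 : 'M[R]_(k1, k3)) Y2 Y3 Z3
    (u : 'cV[R]_k1) (v : 'cV[R]_k2) (w : 'cV[R]_k3) :
  dot (col_mx u (col_mx v w))
      (symblock3 X1 X2 X3 Y2 Y3 Z3 *m col_mx u (col_mx v w)) =
  dot u (X1 *m u) + 2 * dot u (X2 *m v) + 2 * dot u (X3 *m w) +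
  dot v (Y2 *m v) + 2 * dot v (Y3 *m w) + dot w (Z3 *m w).
Proof. by rewrite !symblock2_form mul_row_col dotDr; ring. Qed.

(** Maximizing over [b], at [b = invmx Xi *m g], gives the form of the
    constraint on the uncertainty at the pair [(g, a)]; keeping [b] free avoids
    the inverse and makes the form additive over block-diagonal data. *)
Definition mform k l (Xi : 'M[R]_k) (Lam : 'M[R]_(k, l)) (Gam : 'M[R]_l)
    (g : 'cV[R]_k) (a : 'cV[R]_l) (b : 'cV[R]_k) : R :=
  2 * dot g (Lam *m a) + dot a (Gam *m a) + 2 * dot g b - dot b (Xi *m b).

Lemma mform_dsum k l k' l' (Xi : 'M[R]_k) (Lam : 'M[R]_(k, l)) Gam
    (Xi' : 'M[R]_k') (Lam' : 'M[R]_(k', l')) Gam' g a b g' a' b' :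
  mform (dsum Xi Xi') (dsum Lam Lam') (dsum Gam Gam')
        (col_mx g g') (col_mx a a') (col_mx b b') =
  mform Xi Lam Gam g a b + mform Xi' Lam' Gam' g' a' b'.
Proof. by rewrite /mform !dsum_col !dot_col; ring. Qed.

Lemma mform_zero k l (Xi : 'M[R]_k) (Lam : 'M[R]_(k, l)) Gam :
  mform Xi Lam Gam 0 0 0 = 0.
Proof. by rewrite /mform !mulmx0 !dot0r !mulr0 subr0 !addr0. Qed.

(** The pairs [(F *m x, x)] are the signals of the uncertainty loop closed on
    itself without exogenous input. *)
Definition strict_on_graph k l (F : 'M[R]_(k, l)) (Xi : 'M[R]_k) Lam Gam :=
  forall x b, x != 0 -> mform Xi Lam Gam (F *m x) x b < 0.

Lemma strict_on_graph_dsum k l k' l' (F : 'M[R]_(k, l)) (F' : 'M[R]_(k', l'))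
    Xi Lam Gam Xi' Lam' Gam' :
  strict_on_graph (dsum F F') (dsum Xi Xi') (dsum Lam Lam') (dsum Gam Gam') ->
  strict_on_graph F Xi Lam Gam /\ strict_on_graph F' Xi' Lam' Gam'.
Proof.
move=> strict; split=> x b x0.
- have := strict (col_mx x 0) (col_mx b 0).
  rewrite dsum_col mform_dsum mulmx0 mform_zero addr0; apply.
  by rewrite col_mx_eq0 negb_and x0.
- have := strict (col_mx 0 x) (col_mx 0 b).
  rewrite dsum_col mform_dsum mulmx0 mform_zero add0r; apply.
  by rewrite col_mx_eq0 negb_and x0 orbT.
Qed.

Lemma strict_on_graph_dsum4 k1 l1 k2 l2 k3 l3 k4 l4
    (F1 : 'M[R]_(k1, l1)) (F2 : 'M[R]_(k2, l2)) (F3 : 'M[R]_(k3, l3))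
    (F4 : 'M[R]_(k4, l4)) Xi1 Xi2 Xi3 Xi4 Lam1 Lam2 Lam3 Lam4
    Gam1 Gam2 Gam3 Gam4 :
  strict_on_graph (dsum4 F1 F2 F3 F4) (dsum4 Xi1 Xi2 Xi3 Xi4)
    (dsum4 Lam1 Lam2 Lam3 Lam4) (dsum4 Gam1 Gam2 Gam3 Gam4) ->
  [/\ strict_on_graph F1 Xi1 Lam1 Gam1, strict_on_graph F2 Xi2 Lam2 Gam2,
      strict_on_graph F3 Xi3 Lam3 Gam3 & strict_on_graph F4 Xi4 Lam4 Gam4].
Proof.
by case/strict_on_graph_dsum=> ? /strict_on_graph_dsum[?
  /strict_on_graph_dsum[]].
Qed.

(** Testing the inequality on the vector [(x, x, - b)] makes the identity
    blocks cancel. *)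
Lemma posdef_strict_on_graph k l (F : 'M[R]_(k, l)) Xi Lam Gam c : 0 < c ->
  posdefmx (symblock3 1%:M (- 1%:M - c *: (F^T *m Lam)) (c *: F^T)
                      (1%:M - c *: Gam) 0 (c *: Xi)) ->
  strict_on_graph F Xi Lam Gam.
Proof.
move=> c0 [_ pos] x b x0; have := pos (col_mx x (col_mx x (- b))).
rewrite quadE symblock3_form col_mx_eq0 negb_and x0 => /(_ isT).
rewrite !(mulmxDl, mulNmx, mulmxN, mul0mx, mul1mx, dotDr, dotNl, dotNr).
rewrite -!scalemxAl -mulmxA !dotZr !dot_trmx dot0r /mform.
rewrite -(pmulr_rlt0 _ c0); lra.
Qed.

End MultiplierForm.

Section Channels.
Context {R : realType}.

Lemma posdef_unitmx k (X : 'M[R]_k) : posdefmx X -> X \in unitmx.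
Proof.
move=> [_ pos]; rewrite -row_free_unit -kermx_eq0; apply/eqP/row_matrixP => i.
rewrite row0; apply/eqP/negPn/negP => ki0.
have : (row i (kermx X))^T != 0 by rewrite trmx_eq0.
move=> /pos; rewrite trmxK -row_mul mulmx_ker row0 mul0mx mxE ltxx //.
Qed.

(** At [b = invmx Xi *m g] the multiplier form is the quadratic form whose
    nonnegativity defines [admissible], evaluated at [g]. *)
Lemma channel_multiplier k l (c : channel R k l) De (g : 'cV[R]_(ca c)) a :
  admissible De -> a = De *m g ->
  0 <= mform (cXi c) (cLam c) (cGam c) g a (invmx (cXi c) *m g).
Proof.
move=> [_ /(_ g)]; rewrite quadE -2!mulmxA (mulmxA _ _ g) -mulmxA dot_trmx.
rewrite mul_col_mx mul1mx => + aE; rewrite -aE symblock2_form /mform.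
by rewrite mulKVmx ?(posdef_unitmx (cXi_pos c))// (dotC (_ *m g) g); lra.
Qed.

(** A kernel vector [x] of [1%:M - De *m F] satisfies [x = De *m (F *m x)], so
    that the multiplier form would be both nonnegative and negative there. *)
Lemma strict_well_posed k l (c : channel R k l) :
  strict_on_graph (cF c) (cXi c) (cLam c) (cGam c) -> well_posed c.
Proof.
move=> strict De adm; rewrite -unitmx_tr -row_free_unit -kermx_eq0.
apply/eqP/row_matrixP => i; rewrite row0; set k0 := row i _.
apply/eqP/negPn/negP; rewrite -trmx_eq0 => x0.
have : (1%:M - De *m cF c) *m k0^T = 0.
  by rewrite -[LHS]trmxK trmx_mul trmxK /k0 -row_mul mulmx_ker row0 trmx0.
rewrite mulmxBl mul1mx -mulmxA => /eqP; rewrite subr_eq0 => /eqP xE.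
have := channel_multiplier adm xE.
by rewrite leNgt strict.
Qed.

(** The input [a] solves the loop equation [a = De *m (H *m th + F *m a)]. With
    it the linear fractional perturbation is an exogenous signal about which
    only a quadratic inequality is remembered. *)
Lemma perturbation_input k l (c : channel R k l) De (th : 'cV[R]_l) :
  admissible De -> (1%:M - De *m cF c) \in unitmx ->
  exists a b, perturbation De *m th = cG c *m a /\
    0 <= mform (cXi c) (cLam c) (cGam c) (cH c *m th + cF c *m a) a b.
Proof.
move=> adm unit.
pose a := invmx (1%:M - De *m cF c) *m (De *m (cH c *m th)).
exists a, (invmx (cXi c) *m (cH c *m th + cF c *m a)); split.
  by rewrite /perturbation /a !mulmxA.
apply: (channel_multiplier adm); rewrite mulmxDr.
apply/eqP; rewrite -subr_eq [De *m (cF c *m a)]mulmxA -{1}[a]mul1mx -mulmxBl.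
by rewrite /a mulKVmx.
Qed.

End Channels.

(** * From the matrix inequality to a pointwise dissipation inequality *)

Section DissipationFromLMI.
Context {R : realType}.

Lemma dot_Sy k (X : 'M[R]_k) u : dot u (Sy X *m u) = 2 * dot u (X *m u).
Proof. by rewrite /Sy mulmxDl dotDr dot_trmx (dotC (X *m u)); ring. Qed.

Lemma dot_mulmx k l (X : 'M[R]_(k, l)) u v : dot u (X *m v) = dot (X^T *m u) v.
Proof. by rewrite -dot_trmx trmxK. Qed.

Lemma row4_col4 k n1 n2 n3 n4 (X1 : 'M[R]_(k, n1)) (X2 : 'M[R]_(k, n2))
    (X3 : 'M[R]_(k, n3)) (X4 : 'M[R]_(k, n4)) (a : 'cV[R]_n1) b c d :
  row4 X1 X2 X3 X4 *m col4 a b c d =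
  X1 *m a + (X2 *m b + (X3 *m c + X4 *m d)).
Proof. by rewrite /row4 /col4 !mul_row_col. Qed.

Lemma col4_mulmx k n1 n2 n3 n4 (X1 : 'M[R]_(n1, k)) (X2 : 'M[R]_(n2, k))
    (X3 : 'M[R]_(n3, k)) (X4 : 'M[R]_(n4, k)) (a : 'cV[R]_k) :
  col4 X1 X2 X3 X4 *m a = col4 (X1 *m a) (X2 *m a) (X3 *m a) (X4 *m a).
Proof. by rewrite /col4 !mul_col_mx. Qed.

Lemma dsum4_col4 m1 m2 m3 m4 n1 n2 n3 n4 (X1 : 'M[R]_(m1, n1))
    (X2 : 'M[R]_(m2, n2)) (X3 : 'M[R]_(m3, n3)) (X4 : 'M[R]_(m4, n4))
    (a : 'cV[R]_n1) b c d :
  dsum4 X1 X2 X3 X4 *m col4 a b c d =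
  col4 (X1 *m a) (X2 *m b) (X3 *m c) (X4 *m d).
Proof. by rewrite /dsum4 /col4 !dsum_col. Qed.

Lemma dot_col4 n1 n2 n3 n4 (a a' : 'cV[R]_n1) (b b' : 'cV[R]_n2)
    (c c' : 'cV[R]_n3) (d d' : 'cV[R]_n4) :
  dot (col4 a b c d) (col4 a' b' c' d') =
  dot a a' + (dot b b' + (dot c c' + dot d d')).
Proof. by rewrite /col4 !dot_col. Qed.

Lemma dot_col5 n1 n2 n3 n4 n5 k (a : 'cV[R]_n1) (b : 'cV[R]_n2)
    (c : 'cV[R]_n3) (d : 'cV[R]_n4) (y : 'cV[R]_n5) (X1 : 'M[R]_(n1, k))
    X2 X3 X4 X5 v :
  dot (col_mx (col4 a b c d) y) (col_mx (col4 X1 X2 X3 X4) X5 *m v) =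
  dot a (X1 *m v) + (dot b (X2 *m v) + (dot c (X3 *m v) + dot d (X4 *m v))) +
  dot y (X5 *m v).
Proof. by rewrite mul_col_mx col4_mulmx dot_col dot_col4. Qed.

Lemma add_col4 n1 n2 n3 n4 (a a' : 'cV[R]_n1) (b b' : 'cV[R]_n2)
    (c c' : 'cV[R]_n3) (d d' : 'cV[R]_n4) :
  col4 a b c d + col4 a' b' c' d' = col4 (a + a') (b + b') (c + c') (d + d').
Proof. by rewrite /col4 !add_col_mx. Qed.

Lemma mform_dsum4 k1 l1 k2 l2 k3 l3 k4 l4 (Xi1 : 'M[R]_k1) (Xi2 : 'M[R]_k2)
    (Xi3 : 'M[R]_k3) (Xi4 : 'M[R]_k4) (Lam1 : 'M[R]_(k1, l1))
    (Lam2 : 'M[R]_(k2, l2)) (Lam3 : 'M[R]_(k3, l3)) (Lam4 : 'M[R]_(k4, l4))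
    Gam1 Gam2 Gam3 Gam4 g1 g2 g3 g4 a1 a2 a3 a4 b1 b2 b3 b4 :
  mform (dsum4 Xi1 Xi2 Xi3 Xi4) (dsum4 Lam1 Lam2 Lam3 Lam4)
        (dsum4 Gam1 Gam2 Gam3 Gam4)
        (col4 g1 g2 g3 g4) (col4 a1 a2 a3 a4) (col4 b1 b2 b3 b4) =
  mform Xi1 Lam1 Gam1 g1 a1 b1 + (mform Xi2 Lam2 Gam2 g2 a2 b2 +
  (mform Xi3 Lam3 Gam3 g3 a3 b3 + mform Xi4 Lam4 Gam4 g4 a4 b4)).
Proof. by rewrite /dsum4 /col4 !mform_dsum. Qed.

Lemma norm_col_mx_l k l (u : 'cV[R]_k) (v : 'cV[R]_l) : `|u| <= `|col_mx u v|.
Proof.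
by apply: norm_le_coord => // i j; rewrite -(col_mxEu u v) coord_le_norm.
Qed.

(** The S-procedure: the nominal form, in which [al] is the input produced by
    the uncertainty, is augmented by [c] times the multiplier form, nonnegative
    for the signals of an admissible uncertainty. *)
Lemma lmi_form k a b (Psi : 'M[R]_k) (G : 'M[R]_(k, b)) (H : 'M[R]_(a, k))
    (F : 'M[R]_(a, b)) (Xi : 'M[R]_a) (Lam : 'M[R]_(a, b)) (Gam : 'M[R]_b)
    (c : R) (u : 'cV[R]_k) (al : 'cV[R]_b) (be : 'cV[R]_a) :
  let v := col_mx u (col_mx al be) in
  dot v (symblock3 Psi (G + c *: (H^T *m Lam)) (c *: H^T)
           (c *: (F^T *m Lam) + c *: (Lam^T *m F) + c *: Gam) (c *: F^T)
           (- (c *: Xi)) *m v) =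
  dot u (Psi *m u) + 2 * dot u (G *m al) +
  c * mform Xi Lam Gam (H *m u + F *m al) al be.
Proof.
rewrite /= symblock3_form !(mulmxDl, mulNmx) -!scalemxAl -!mulmxA.
rewrite !(dotDr, dotDl, dotNr, dotZr) !dot_trmx /mform !dotDl.
by rewrite (dotC (Lam *m al)); ring.
Qed.

(** The inequality is tested on the inputs [a1], ..., [a8] produced by the
    uncertainties and on vectors [b1], ..., [b8] at which the multiplier forms
    are nonnegative. The vector [y] linearizes the term of the supply rate that
    is quadratic in the output; it is left free because dissipativity and
    stability call for different choices. *)
Lemma lmi_dissipation nu m l q (r : R) (k0 kr : 'M[R]_(l, nu)) (N W : 'M[R]_l)
    (E0 : 'M[R]_(nu, nu + (nu + (l + q)))) (C0 : 'M[R]_(m, _))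
    (c1 c2 : channel R nu nu) (c3 : channel R nu l) (c4 : channel R nu q)
    (c5 c6 : channel R m nu) (c7 : channel R m l) (c8 : channel R m q)
    (J1 Jt : 'M[R]_m) (J2 : 'M[R]_(m, q)) (J3 : 'M[R]_q)
    (P : 'M[R]_nu) (Q : 'M[R]_(nu, l)) (Rm : 'M[R]_l) (S U : 'M[R]_nu) (k : R) :
  P^T = P -> Rm^T = Rm -> 0 < k ->
  [/\ well_posed c1, well_posed c2, well_posed c3 & well_posed c4] ->
  [/\ well_posed c5, well_posed c6, well_posed c7 & well_posed c8] ->
  let bF := dsum (dsum4 (cF c1) (cF c2) (cF c3) (cF c4))
                 (dsum4 (cF c5) (cF c6) (cF c7) (cF c8)) in
  let bJ1 := dsum (dsum4 (cXi c1) (cXi c2) (cXi c3) (cXi c4))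
                  (dsum4 (cXi c5) (cXi c6) (cXi c7) (cXi c8)) in
  let bJ2 := dsum (dsum4 (cLam c1) (cLam c2) (cLam c3) (cLam c4))
                  (dsum4 (cLam c5) (cLam c6) (cLam c7) (cLam c8)) in
  let bJ3 := dsum (dsum4 (cGam c1) (cGam c2) (cGam c3) (cGam c4))
                  (dsum4 (cGam c5) (cGam c6) (cGam c7) (cGam c8)) in
  let bG := block_mx (col4 P 0 Q^T (0 : 'M[R]_(q, nu)))
                     (col4 (0 : 'M[R]_(nu, m)) 0 (0 : 'M[R]_(l, m)) (- J2^T))
                     0 Jt *m
            dsum (row4 (cG c1) (cG c2) (cG c3) (cG c4))
                 (row4 (cG c5) (cG c6) (cG c7) (cG c8)) in
  let bH := col_mx (dsum4 (cH c1) (cH c2) (cH c3) (cH c4))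
                   (dsum4 (cH c5) (cH c6) (cH c7) (cH c8)) *m
            row_mx 1%:M (0 : 'M[R]_(_, m)) in
  let bP := row_mx (row4 P 0 Q 0) (0 : 'M[R]_(nu, m)) in
  let bPhi :=
    Sy (col_mx (col4 Q 0 Rm 0) 0 *m row_mx (row4 k0 (- kr) (- N) 0) 0)
    + dsum (dsum4 (S + r *: U) (- S) (- W) (- J3)) J1
    + Sy (col_mx (col4 0 0 0 (- J2^T)) Jt *m row_mx C0 0) in
  negdefmx (symblock3 (bPhi + Sy (bP^T *m row_mx E0 0))
                      (bG + k *: (bH^T *m bJ2)) (k *: bH^T)
                      (k *: (bF^T *m bJ2) + k *: (bJ2^T *m bF) + k *: bJ3)
                      (k *: bF^T) (- (k *: bJ1))) ->
  exists2 e, 0 < e & forall E C,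
    uncertain_system E0 C0 c1 c2 c3 c4 c5 c6 c7 c8 (E, C) ->
    forall (a b : 'cV[R]_nu) (z : 'cV[R]_l) (w : 'cV[R]_q) (y : 'cV[R]_m),
    2 * dot (E *m col4 a b z w) (P *m a + Q *m z) +
    2 * dot (k0 *m a - kr *m b - N *m z) (Q^T *m a + Rm *m z) +
    dot a ((S + r *: U) *m a) - dot b (S *m b) - dot z (W *m z) -
    dot w (J3 *m w) - 2 * dot (C *m col4 a b z w) (J2 *m w) +
    2 * dot y (Jt *m (C *m col4 a b z w)) + dot y (J1 *m y) <= - e * `|a| ^+ 2.
Proof.
move=> P_sym R_sym k_gt0 [wp1 wp2 wp3 wp4] [wp5 wp6 wp7 wp8].
move=> bF bJ1 bJ2 bJ3 bG bH bP bPhi /posdef_coercive[e e0 coercive].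
exists e => // E C [D1 [D2 [D3 [D4 [D5 [D6 [D7 [D8]]]]]]]].
move=> [[ad1 ad2 ad3 ad4]] [[ad5 ad6 ad7 ad8]] [-> ->] a b z w y.
pose th := col4 a b z w.
have [a1 [b1 [E1 pos1]]] := perturbation_input a ad1 (wp1 _ ad1).
have [a2 [b2 [E2 pos2]]] := perturbation_input b ad2 (wp2 _ ad2).
have [a3 [b3 [E3 pos3]]] := perturbation_input z ad3 (wp3 _ ad3).
have [a4 [b4 [E4 pos4]]] := perturbation_input w ad4 (wp4 _ ad4).
have [a5 [b5 [E5 pos5]]] := perturbation_input a ad5 (wp5 _ ad5).
have [a6 [b6 [E6 pos6]]] := perturbation_input b ad6 (wp6 _ ad6).
have [a7 [b7 [E7 pos7]]] := perturbation_input z ad7 (wp7 _ ad7).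
have [a8 [b8 [E8 pos8]]] := perturbation_input w ad8 (wp8 _ ad8).
rewrite !mulmxDl !row4_col4 E1 E2 E3 E4 E5 E6 E7 E8.
set x1 := cG c1 *m a1 + _; set z1 := cG c5 *m a5 + _.
pose al := col_mx (col4 a1 a2 a3 a4) (col4 a5 a6 a7 a8).
pose be := col_mx (col4 b1 b2 b3 b4) (col4 b5 b6 b7 b8).
pose u := col_mx th y.
have uv : `|a| ^+ 2 <= `|col_mx u (col_mx al be)| ^+ 2.
  rewrite ler_sqr ?nnegrE// (le_trans _ (norm_col_mx_l _ _))//.
  by rewrite (le_trans _ (norm_col_mx_l _ _))// norm_col_mx_l.
have := coercive (col_mx u (col_mx al be)).
rewrite mulNmx dotNr lmi_form.
have -> : bH *m u = col_mx (col4 (cH c1 *m a) (cH c2 *m b) (cH c3 *m z)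
  (cH c4 *m w))
                      (col4 (cH c5 *m a) (cH c6 *m b) (cH c7 *m z)
                        (cH c8 *m w)).
  by rewrite /bH -mulmxA mul_row_col mul1mx mul0mx addr0 mul_col_mx !dsum4_col4.
have -> : bF *m al = col_mx (col4 (cF c1 *m a1) (cF c2 *m a2) (cF c3 *m a3)
  (cF c4 *m a4))
                      (col4 (cF c5 *m a5) (cF c6 *m a6) (cF c7 *m a7)
                        (cF c8 *m a8)).
  by rewrite dsum_col !dsum4_col4.
rewrite add_col_mx !add_col4 mform_dsum !mform_dsum4.
set mf := (X in k * X); have mf_ge0 : 0 <= k * mf.
  by apply: mulr_ge0; [exact: ltW|rewrite /mf; lra].
have -> : bG *m al = col_mx (col4 (P *m x1) 0 (Q^T *m x1) (- (J2^T *m z1)))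
  (Jt *m z1).
  rewrite /bG -mulmxA dsum_col !row4_col4 mul_block_col !col4_mulmx.
  by rewrite !mul0mx mulNmx add_col4 !(addr0, add0r).
rewrite dot_col dot_col4 dot0r dotNr.
have dotth x : dot u (Sy (bP^T *m row_mx E0 0) *m u) = x -> x = 2 * dot (E0 *m
  th) (P *m a + Q *m z).
  move=> <-; rewrite dot_Sy -mulmxA dot_trmx /bP /u /th.
  rewrite [row_mx E0 _ *m _]mul_row_col [row_mx _ _ *m _]mul_row_col.
  by rewrite row4_col4 !mul0mx !(addr0, add0r) dotC.
rewrite [_ *m u]mulmxDl dotDr (dotth _ erefl) {dotth}.
have -> : dot u (bPhi *m u) = 2 * dot (k0 *m a - kr *m b - N *m z)
  (Q^T *m a + Rm *m z)
   + (dot a ((S + r *: U) *m a) - dot b (S *m b) - dot z (W *m z) -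
    dot w (J3 *m w)) + dot y (J1 *m y) + 2 * (dot y (Jt *m (C0 *m th)) - dot
      (C0 *m th) (J2 *m w)).
  rewrite /bPhi /u /th [(_ + Sy _) *m _]mulmxDl [(Sy _ + _) *m _]mulmxDl !dotDr
    !dot_Sy -!mulmxA.
  rewrite [row_mx C0 _ *m _]mul_row_col [row_mx (row4 _ _ _ _) _ *m
    _]mul_row_col.
  rewrite !dot_col5 dsum_col dsum4_col4 dot_col dot_col4 row4_col4.
  rewrite !mul0mx !dot0r !mulNmx !dotNr !addr0 [dot w (_ *m (C0 *m _))]dot_trmx
    (dotC (J2 *m w)).
  set g := k0 *m a + (- (kr *m b) + - (N *m z)).
  have -> : k0 *m a - kr *m b - N *m z = g by rewrite /g addrA.
  rewrite (dot_sym z g R_sym) (dot_mulmx Q a) (dotC _ g); ring.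
clearbody x1 z1 mf.
rewrite !mulmxDl !(mulmxDr, dotDl, dotDr, dotNr) !dot_trmx.
rewrite -/th (dot_sym a x1 P_sym) (dotC (Q *m z)) (dotC (J2 *m w)) => lmi.
have := ler_wpM2l (ltW e0) uv; lra.
Qed.

End DissipationFromLMI.

(** * Scalar integrals with a distributed delay *)

Section ScalarIntegrals.
Context {R : realType}.
Notation mu := (@lebesgue_measure R).
Implicit Types (f g k : R -> R) (a b : R).

Lemma continuous_integrable f a b : continuous f ->
  mu.-integrable `[a, b] (EFin \o f).
Proof.
move=> cf; apply: continuous_compact_integrable; first exact: segment_compact.
exact: continuous_subspaceT.
Qed.

Lemma is_derive_continuous f g : (forall x : R, is_derive x 1 f (g x)) ->
  continuous f.
Proof.
by move=> df x; apply/differentiable_continuous/derivable1_diffP/ex_derive.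
Qed.

Lemma is_derive_eqE f (x d : R) : is_derive x 1 f d -> derive1 f x = d.
Proof. by move=> df; rewrite derive1E derive_val. Qed.

Lemma continuous_antiderivative g : continuous g ->
  exists G : R -> R, forall x : R, is_derive x 1 G (g x).
Proof.
move=> cg; pose G x := if 0 <= x then \int[mu]_(t in `[0, x]) g t
                       else - \int[mu]_(t in `[x, 0]) g t.
(* [a] lies to the left of [0] and of [x], so that near [x] the function [G]
   is an integral from [a], up to a constant *)
exists G => x; pose a := Num.min x 0 - 1.
have a_x : a < x by rewrite /a ltrBlDr gt_min ltrDl ltr01.
have a_0 : a < 0 by rewrite /a ltrBlDr gt_min add0r ltr01 orbT.
pose Ga y := \int[mu]_(t in `[a, y]) g t.
have x_x1 : x < x + 1 by rewrite ltrDl.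
have [dGa Ga'] := continuous_FTC1_closed x_x1 (continuous_integrable a (x + 1)
  cg) a_x (cg x).
have GE y : a < y -> G y = Ga y - Ga 0.
  move=> ay; rewrite /G /Ga; case: ifPn => [y0|]; last rewrite -ltNge => y0.
    rewrite (@Rintegral_itvB _ g (BLeft a) (BRight y) 0) ?bnd_simp//.
    - rewrite Rintegral_itv_obnd_cbnd//;
      apply: integrableS (continuous_integrable 0 y cg) => //.
      exact: subset_itv_oc_cc.
    - exact: continuous_integrable.
    - exact: ltW.
  rewrite -[RHS]opprB (@Rintegral_itvB _ g (BLeft a) (BRight 0) y) ?bnd_simp//.
  - rewrite Rintegral_itv_obnd_cbnd//;
    apply: integrableS (continuous_integrable y 0 cg) => //.
    exact: subset_itv_oc_cc.
  - exact: continuous_integrable.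
  - exact: ltW.
  - exact: ltW.
have : is_derive x 1 (fun y => Ga y - Ga 0) (g x).
  have : is_derive x 1 Ga (g x).
    by apply: DeriveDef; [exact: dGa|rewrite -derive1E; exact: Ga'].
  by move=> H; rewrite -[g x]subr0; apply: is_deriveB.
apply: near_eq_is_derive.
by near=> y; apply/esym/GE; near: y; exact: lt_nbhsr.
Unshelve. all: by end_near. Qed.

Lemma Rintegral_antiderivative g G a b : a <= b -> continuous g ->
  (forall x : R, is_derive x 1 G (g x)) ->
  \int[mu]_(t in `[a, b]) g t = G b - G a.
Proof.
rewrite le_eqVlt => /predU1P[-> _ _|ab cg dG].
  by rewrite set_itv1 Rintegral_set1 subrr.
have cG := is_derive_continuous dG.
rewrite /Rintegral (@continuous_FTC2 _ g G)//.
- exact: continuous_subspaceT.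
- split => [x _||]; first exact: ex_derive.
  + exact/cvg_at_right_filter/cG.
  + exact/cvg_at_left_filter/cG.
- by move=> x _; exact: is_derive_eqE.
Qed.

Lemma is_derive_comp_addl g (x y d : R) :
  is_derive (x + y) 1 g d -> is_derive x 1 (fun s => g (s + y)) d.
Proof.
move=> dg; have := @is_derive1_comp _ g (shift y) x d 1 dg (is_derive_shift _ _
  _).
by rewrite mulr1.
Qed.

Lemma continuous_translate g y : continuous g -> continuous (fun s => g (y +
  s)).
Proof.
move=> cg x; apply: (@continuous_comp _ _ _ (fun s => y + s) g).
  by apply: cvgD; [exact: cvg_cst|exact: cvg_id].
exact: cg.
Qed.

(** Integrating by parts moves the time derivative from [g], which is merely
    continuous, to a primitive of [g], where differentiation under the
    integral sign applies. *)
Lemma distributed_delay_derive k k' g (r t : R) : 0 < r ->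
  (forall x : R, is_derive x 1 k (k' x)) -> continuous k' -> continuous g ->
  is_derive t 1 (fun s => \int[mu]_(x in `[- r, 0]) (k x * g (s + x)))
    (k 0 * g t - k (- r) * g (t - r) -
     \int[mu]_(x in `[- r, 0]) (k' x * g (t + x))).
Proof.
move=> r0 dk ck' cg; have ck := is_derive_continuous dk.
have [G dG] := continuous_antiderivative cg.
have cG := is_derive_continuous dG.
have r0' : - r < 0 by rewrite oppr_lt0.
pose f s x := k' x * G (s + x).
have parts s : \int[mu]_(x in `[- r, 0]) (k x * g (s + x)) =
    k 0 * G s - k (- r) * G (s - r) - \int[mu]_(x in `[- r, 0]) f s x.
  have dGs (x : R) : is_derive x 1 (fun x => G (s + x)) (g (s + x)).
    rewrite (_ : (fun x => _) = fun x => G (x + s)); last first.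
      by apply/funext => y; rewrite addrC.
    by apply: is_derive_comp_addl; rewrite addrC.
  rewrite (@Rintegration_by_parts _ k (fun x => G (s + x)) k' (fun x => g (s +
    x)))//.
  - by rewrite addr0.
  - exact: continuous_subspaceT.
  - split => [x _||]; first exact: ex_derive.
    + exact/cvg_at_right_filter/ck.
    + exact/cvg_at_left_filter/ck.
  - by move=> x _; exact: is_derive_eqE.
  - by apply: continuous_subspaceT; exact: continuous_translate.
  - split => [x _||]; first exact: ex_derive.
    + exact/cvg_at_right_filter/continuous_translate.
    + exact/cvg_at_left_filter/continuous_translate.
  - by move=> x _; exact: is_derive_eqE.
rewrite (_ : (fun s => _) = fun s => k 0 * G s - k (- r) * G (s - r) -
    \int[mu]_(x in `[- r, 0]) f s x); last by apply/funext => s; exact: parts.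
have df (s x : R) : is_derive s 1 (f^~ x) (k' x * g (s + x)).
  have := is_derive_comp_addl (dG (s + x)).
  by move=> H; rewrite /f;
    apply: (@is_deriveZ _ _ _ (fun s => G (s + x)) (k' x)).
have dfE s x : partial1of2 f s x = k' x * g (s + x).
  by rewrite partial1of2E derive_val.
have dint : is_derive t 1 (fun s => \int[mu]_(x in `[- r, 0]) f s x)
              (\int[mu]_(x in `[- r, 0]) (k' x * g (t + x))).
  have It : `]t - 1, t + 1[%classic t
    by rewrite /= in_itv/= ltrBlDr ltrDl ltr01.
  (* for [s] within [1] of [t] the derivative of the integrand is dominated by
     a constant *)
  have [Ck kC] : exists C, forall x, x \in `[- r, 0] -> `|k' x| <= C.
    have [c _ cmax] := @EVT_max _ (fun x => `|k' x|) _ _ (ltW r0')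
      (continuous_subspaceT (fun x => cvg_norm (ck' x))).
    by exists (`|k' c|).
  have [Cg gC] : exists C, forall x, x \in `[t - 1 - r, t + 1] -> `|g x| <= C.
    have le : t - 1 - r <= t + 1 by lra.
    have [c _ cmax] := @EVT_max _ (fun x => `|g x|) _ _ le
      (continuous_subspaceT (fun x => cvg_norm (cg x))).
    by exists (`|g c|).
  have intf s : `]t - 1, t + 1[%classic s -> mu.-integrable `[- r,
    0] (EFin \o f s).
    move=> _; apply: continuous_integrable => x.
    by apply: cvgM; [exact: ck'|exact: continuous_translate].
  have derf s x : `]t - 1, t + 1[%classic s -> `[- r, 0]%classic x ->
      derivable (f^~ x) s 1 by move=> _ _; exact: ex_derive.
  have bound s x : `]t - 1, t + 1[%classic s -> `[- r, 0]%classic x ->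
      `|partial1of2 f s x| <= `|Ck * Cg|.
    move=> /=; rewrite !in_itv/= => /andP[s1 s2] /andP[x1 x2].
    rewrite dfE normrM (le_trans _ (ler_norm _))// ler_pM//.
    - by apply: kC; rewrite in_itv/= x1.
    - by apply: gC; rewrite in_itv/=; apply/andP; split; lra.
  have intC : mu.-integrable `[- r, 0] (EFin \o fun=> `|Ck * Cg|).
    by apply: continuous_integrable => x; exact: cvg_cst.
  apply: DeriveDef.
    exact: (derivable_under_integral _ It intf derf _ intC bound).
  rewrite -derive1E (differentiation_under_integral _ It intf derf _ intC
    bound)//.
  by apply: eq_Rintegral => x _; rewrite dfE.
apply: is_deriveB; apply: is_deriveB; apply: is_deriveZ.
by apply: is_derive_comp_addl.
Qed.

End ScalarIntegrals.

(** * One-sided derivatives *)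

Section OneSidedDerivatives.
Context {R : realType}.

Lemma is_derive_has_deriv_from (V : normedModType R) (t0 t : R) (y : R -> V) l :
  is_derive t 1 y l -> has_deriv_from t0 y t l.
Proof.
move=> [dy <-]; apply: cvg_within_filter.
have shift_cvg : (fun s => s - t) s @[s --> t^'] --> (0 : R)^'.
  move=> A; rewrite /dnbhs /within /= => /nbhs_ballP[e /= e0 Ae].
  apply/nbhs_ballP; exists e => //= s ts st; apply: Ae.
    by move: ts; rewrite /ball /= sub0r opprB.
  by rewrite subr_eq0.
have := cvg_comp _ _ shift_cvg dy; apply: cvg_trans; apply: near_eq_cvg.
by near=> s; rewrite /= scaler1 subrK.
Unshelve. all: by end_near. Qed.

Lemma has_deriv_from_is_derive (t0 t : R) (y : R -> R) (l : R) : t0 < t ->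
  has_deriv_from t0 (y : R -> R^o) t l -> is_derive t 1 y l.
Proof.
move=> t0t dy.
have : h^-1 *: (y (h *: 1 + t) - y t) @[h --> (0 : R)^'] --> l.
  have shift_cvg : (fun h => h + t) h @[h --> (0 : R)^'] --> within `[t0,
    +oo[ t^'.
    move=> A; rewrite /dnbhs /within /= => /nbhs_ballP[e /= e0 Ae].
    apply/nbhs_ballP; exists (Num.min e (t - t0)).
      by rewrite /= lt_min e0 subr_gt0.
    move=> h /=; rewrite /ball /= sub0r normrN lt_min => /andP[he ht] h0.
    apply: Ae; rewrite /ball /=.
    - by rewrite opprD addrC subrK normrN.
    - by rewrite -subr_eq0 addrK.
    - by move: ht; rewrite in_itv/= andbT ltr_norml; lra.
  have := cvg_comp _ _ shift_cvg dy; apply: cvg_trans; apply: near_eq_cvg.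
  by near=> h; rewrite /= addrK -[h%:A]/(h * 1) mulr1.
move=> cy; apply: DeriveDef; last exact/cvg_lim.
by apply/cvg_ex; exists l.
Unshelve. all: by end_near. Qed.

Lemma eq_has_deriv_from (V : normedModType R) (t0 t : R) (y y' : R -> V) l :
  t0 <= t -> (forall s, t0 <= s -> y s = y' s) ->
  has_deriv_from t0 y t l -> has_deriv_from t0 y' t l.
Proof.
move=> t0t yy'; apply: cvg_trans; apply: near_eq_cvg; rewrite yy'//.
apply: filterS (withinT _ _) => s; rewrite /= in_itv/= andbT => t0s.
by rewrite yy'.
Qed.

Lemma has_deriv_from_ext (V : normedModType R) (t0 t : R) (y y' : R -> V) l l' :
  has_deriv_from t0 y t l -> y =1 y' -> l = l' -> has_deriv_from t0 y' t l'.
Proof. by move=> dy /funext <- <-. Qed.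

Lemma has_deriv_from_continuous (V : normedModType R) (t0 t : R)
  (y : R -> V) l :
  has_deriv_from t0 y t l -> y s @[s --> within `[t0, +oo[ t^'] --> y t.
Proof.
move=> dy.
have st0 : (s - t) @[s --> within `[t0, +oo[ t^'] --> (0 : R).
  have c0 : (s - t) @[s --> t] --> (0 : R).
    by apply/subr_cvg0; exact: cvg_id.
  by apply: cvg_within_filter; exact: cvg_within_filter c0.
have : (s - t) *: ((s - t)^-1 *: (y s - y t)) + y t
    @[s --> within `[t0, +oo[ t^'] --> 0 *: l + y t.
  by apply: cvgD; [exact: cvgZ st0 dy|exact: cvg_cst].
rewrite scale0r add0r; apply: cvg_trans; apply: near_eq_cvg; apply: cvg_within.
apply/nbhs_ballP; exists 1 => //= s _ st.
by rewrite scalerA divff ?subr_eq0// scale1r subrK.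
Qed.

Lemma has_deriv_cst (V : normedModType R) (t0 t : R) (c : V) :
  has_deriv_from t0 (fun=> c) t 0.
Proof.
by rewrite /has_deriv_from; under eq_fun do rewrite subrr scaler0;
  exact: cvg_cst.
Qed.

Lemma has_derivD (V : normedModType R) (t0 t : R) (y z : R -> V) l l' :
  has_deriv_from t0 y t l -> has_deriv_from t0 z t l' ->
  has_deriv_from t0 (fun s => y s + z s) t (l + l').
Proof.
move=> dy dz.
have : (s - t)^-1 *: (y s - y t) + (s - t)^-1 *: (z s - z t)
    @[s --> within `[t0, +oo[ t^'] --> l + l' by apply: cvgD;
      [exact: dy|exact: dz].
apply: cvg_trans; apply: near_eq_cvg.
by near=> s; rewrite /= -scalerDr addrACA -opprD.
Unshelve. all: by end_near. Qed.

Lemma has_deriv_mulmx k l p (t0 t : R) (X : R -> 'M[R]_(k, l))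
    (Y : R -> 'M[R]_(l, p)) (X' : 'M[R]_(k, l)) (Y' : 'M[R]_(l, p)) :
  has_deriv_from t0 X t X' -> has_deriv_from t0 Y t Y' ->
  has_deriv_from t0 (fun s => X s *m Y s) t (X' *m Y t + X t *m Y').
Proof.
move=> dX dY; have cY := has_deriv_from_continuous dY.
have : (s - t)^-1 *: (X s - X t) *m Y s + X t *m ((s - t)^-1 *: (Y s - Y t))
    @[s --> within `[t0, +oo[ t^'] --> X' *m Y t + X t *m Y'.
  by apply: cvgD; apply: cvg_mulmx => //; exact: cvg_cst.
apply: cvg_trans; apply: near_eq_cvg; near=> s => /=.
rewrite -scalemxAl -scalemxAr -scalerDr mulmxBl mulmxBr; congr (_ *: _).
by rewrite addrA subrK.
Unshelve. all: by end_near. Qed.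

Lemma has_deriv_mx k l (t0 t : R) (X : R -> 'M[R]_(k, l)) (X' : 'M[R]_(k, l)) :
  (forall i j, has_deriv_from t0 (fun s => X s i j : R^o) t (X' i j)) ->
  has_deriv_from t0 X t X'.
Proof.
move=> dX; apply: cvg_mx => i j; have := dX i j; apply: cvg_trans.
by apply: near_eq_cvg; near=> s; rewrite !mxE.
Unshelve. all: by end_near. Qed.

Lemma has_deriv_coord k l (t0 t : R) (X : R -> 'M[R]_(k, l))
  (X' : 'M[R]_(k, l)) i j :
  has_deriv_from t0 X t X' ->
  has_deriv_from t0 (fun s => X s i j : R^o) t (X' i j).
Proof.
move=> dX; have : ((s - t)^-1 *: (X s - X t)) i j
    @[s --> within `[t0, +oo[ t^'] --> X' i j by exact: cvg_coord dX.
apply: cvg_trans.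
by apply: near_eq_cvg; near=> s; rewrite !mxE.
Unshelve. all: by end_near. Qed.

Lemma has_deriv_trmx k l (t0 t : R) (X : R -> 'M[R]_(k, l))
  (X' : 'M[R]_(k, l)) :
  has_deriv_from t0 X t X' -> has_deriv_from t0 (fun s => (X s)^T) t X'^T.
Proof.
move=> dX; apply: has_deriv_mx => i j; rewrite mxE.
by under [X in has_deriv_from _ X]funext do rewrite mxE; exact: has_deriv_coord.
Qed.

Lemma has_deriv_mulmxl k l p (t0 t : R) (A : 'M[R]_(k, l))
  (Y : R -> 'M[R]_(l, p)) (Y' : 'M[R]_(l, p)) :
  has_deriv_from t0 Y t Y' -> has_deriv_from t0 (fun s => A *m Y s) t (A *m Y').
Proof.
by move=> /(has_deriv_mulmx (has_deriv_cst t0 t A)); rewrite mul0mx add0r.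
Qed.

Lemma has_deriv_dot k (t0 t : R) (X Y : R -> 'cV[R]_k) (X' Y' : 'cV[R]_k) :
  has_deriv_from t0 X t X' -> has_deriv_from t0 Y t Y' ->
  has_deriv_from t0 (fun s => dot (X s) (Y s) : R^o) t
    (dot X' (Y t) + dot (X t) Y').
Proof.
move=> /has_deriv_trmx dX dY;
  have := has_deriv_coord (i := 0) (j := 0) (has_deriv_mulmx dX dY).
by rewrite mxE.
Qed.

End OneSidedDerivatives.

(** * Integrals of matrices and Bessel's inequality *)

Section MatrixIntegrals.
Context {R : realType}.
Notation mu := (@lebesgue_measure R).
Context (a b : R).
Local Notation cont X := {within `[a, b], continuous X}.

Lemma within_integrable (f : R -> R) : cont f -> mu.-integrable `[a,
  b] (EFin \o f).
Proof. by move=> cf; apply: continuous_compact_integrable => //;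
  exact: segment_compact. Qed.

Lemma within_cst (T : topologicalType) (c : T) : cont (fun=> c).
Proof. by move=> x; exact: cvg_cst. Qed.

Lemma within_coord k l (X : R -> 'M[R]_(k, l)) i j :
  cont X -> cont (fun s => X s i j).
Proof. by move=> cX x; exact: cvg_coord (cX x). Qed.

Lemma within_mulmx k l p (X : R -> 'M[R]_(k, l)) (Y : R -> 'M[R]_(l, p)) :
  cont X -> cont Y -> cont (fun s => X s *m Y s).
Proof. by move=> cX cY x; exact: cvg_mulmx (cX x) (cY x). Qed.

Lemma within_dot k (X Y : R -> 'cV[R]_k) :
  cont X -> cont Y -> cont (fun s => dot (X s) (Y s)).
Proof. by move=> cX cY x; exact: cvg_dot (cX x) (cY x). Qed.

Lemma Rintegral_sum n (f : 'I_n -> R -> R) : (forall i, cont (f i)) ->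
  \int[mu]_(s in `[a, b]) (\sum_i f i s) = \sum_i \int[mu]_(s in `[a, b]) f i s.
Proof.
elim: n f => [f _|n IHn f cf].
  under eq_Rintegral do rewrite big_ord0.
  by rewrite big_ord0 Rintegral_cst// mul0r.
under eq_Rintegral do rewrite big_ord_recr.
rewrite big_ord_recr /= -IHn// RintegralD//; apply: within_integrable => //.
by move=> x; apply: cvg_sumr => i; exact: cf.
Qed.

Lemma mxint_mulmxl k l p (A : 'M[R]_(k, l)) (X : R -> 'M[R]_(l, p)) : cont X ->
  mxint a b (fun s => A *m X s) = A *m mxint a b X.
Proof.
move=> cX; apply/matrixP => i j; rewrite !mxE.
under eq_Rintegral do rewrite mxE.
rewrite Rintegral_sum => [|c]; last first.
  by move=> x; apply: cvgM; [exact: cvg_cst|exact: cvg_coord (cX x)].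
apply: eq_bigr => c _; rewrite mxE RintegralZl//.
by apply: within_integrable; exact: within_coord.
Qed.

Lemma mxint_mulmxr k l p (A : 'M[R]_(l, p)) (X : R -> 'M[R]_(k, l)) : cont X ->
  mxint a b (fun s => X s *m A) = mxint a b X *m A.
Proof.
move=> cX; apply/matrixP => i j; rewrite !mxE.
under eq_Rintegral do rewrite mxE.
rewrite Rintegral_sum => [|c]; last first.
  by move=> x; apply: cvgM; [exact: cvg_coord (cX x)|exact: cvg_cst].
apply: eq_bigr => c _; rewrite mxE RintegralZr//.
by apply: within_integrable; exact: within_coord.
Qed.

Lemma mxint_linear k l c (X Y : R -> 'M[R]_(k, l)) : cont X -> cont Y ->
  mxint a b (fun s => c *: X s + Y s) = c *: mxint a b X + mxint a b Y.
Proof.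
move=> cX cY; apply/matrixP => i j; rewrite !mxE.
under eq_Rintegral do rewrite !mxE.
have cXij := within_coord (i := i) (j := j) cX;
  have iXij := within_integrable cXij.
rewrite RintegralD ?RintegralZl//; apply: within_integrable.
  by move=> x; apply: cvgM; [exact: cvg_cst|exact: cXij].
exact: within_coord.
Qed.

Lemma Rintegral_form k l (u : 'cV[R]_k) (X : R -> 'M[R]_(k, l)) v : cont X ->
  \int[mu]_(s in `[a, b]) dot u (X s *m v) = dot u (mxint a b X *m v).
Proof.
move=> cX; rewrite /dot -mxint_mulmxr// -mxint_mulmxl ?mxE//.
by apply: within_mulmx; [exact: cX|exact: within_cst].
Qed.

Lemma Rintegral_dot k (u : 'cV[R]_k) (X : R -> 'cV[R]_k) : cont X ->
  \int[mu]_(s in `[a, b]) dot u (X s) = dot u (mxint a b X).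
Proof.
move=> cX; rewrite -[mxint a b X]mulmx1 -Rintegral_form//.
by apply: eq_Rintegral => s _; rewrite mulmx1.
Qed.

Lemma norm_Rintegral_le (f : R -> R) c : a <= b -> cont f ->
  (forall s, s \in `[a, b] -> `|f s| <= c) ->
  `|\int[mu]_(s in `[a, b]) f s| <= c * (b - a).
Proof.
move=> ab cf fc; have if_ := within_integrable cf.
apply: (le_trans (le_normr_Rintegral _ _)) => //.
have -> : c * (b - a) = \int[mu]_(s in `[a, b]) c.
  rewrite Rintegral_cst//; congr (_ * _).
  have := @lebesgue_measure_itv R `[a, b]; rewrite /= => ->; rewrite lte_fin.
  by move: ab; rewrite le_eqVlt => /predU1P[->|->//]; rewrite ltxx subrr.
apply: le_Rintegral => //.
- by apply: within_integrable => x; exact: cvg_norm (cf x).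
- by apply: within_integrable; exact: within_cst.
Qed.

(** Bessel's inequality for the expansion of [phi] along the rows of [ker],
    orthonormal by the hypothesis on the integral: with [z] the vector of
    moments of [phi], the [U]-energy of the residual [phi s - (ker s)^T *m z] is
    nonnegative, and the commutation of [U] with [ker] turns the energy of the
    expansion into the form [W] of [z]. *)
Lemma bessel_form l nu (ker : R -> 'M[R]_(l, nu)) (W : 'M[R]_l) (U : 'M[R]_nu)
    (phi : R -> 'cV[R]_nu) :
  cont ker -> cont phi -> possemidefmx U ->
  (forall s, U *m (ker s)^T = (ker s)^T *m W) ->
  mxint a b (fun s => ker s *m (ker s)^T) = 1%:M ->
  dot (mxint a b (fun s => ker s *m phi s))
      (W *m mxint a b (fun s => ker s *m phi s)) <=
  \int[mu]_(s in `[a, b]) dot (phi s) (U *m phi s).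
Proof.
move=> ck cphi [symU U_ge0] kerW orth.
set z := mxint a b (fun s => ker s *m phi s).
have ckT : cont (fun s => (ker s)^T) by move=> x; exact: cvg_trmx (ck x).
have ckp : cont (fun s => ker s *m phi s) by exact: within_mulmx.
have ckk : cont (fun s => ker s *m (ker s)^T) by exact: within_mulmx.
have cUphi : cont (fun s => U *m phi s) by apply: within_mulmx => //;
  exact: within_cst.
have c1 : cont (fun s => dot (phi s) (U *m phi s)) by exact: within_dot.
have c2' : cont (fun s => dot (W *m z) (ker s *m phi s)).
  by apply: within_dot; [exact: within_cst|exact: ckp].
have c2 : cont (fun s => 2 * dot (W *m z) (ker s *m phi s)).
  by move=> x; apply: cvgM; [exact: cvg_cst|exact: c2'].
have c3 : cont (fun s => dot z (ker s *m (ker s)^T *m (W *m z))).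
  apply: within_dot; first exact: within_cst.
  by apply: within_mulmx; [exact: ckk|exact: within_cst].
have [i1 i2] := (within_integrable c1, within_integrable c2).
have [i2' i3] := (within_integrable c2', within_integrable c3).
have : 0 <= \int[mu]_(s in `[a, b]) (dot (phi s) (U *m phi s) -
    2 * dot (W *m z) (ker s *m phi s) + dot z (ker s *m (ker s)^T *m (W *m z))).
  apply: Rintegral_ge0 => s _; have := U_ge0 (phi s - (ker s)^T *m z).
  have Uv : U *m ((ker s)^T *m z) = (ker s)^T *m (W *m z).
    by rewrite !mulmxA kerW.
  rewrite quadE mulmxBr !(dotDl, dotNl, dotDr, dotNr) Uv.
  rewrite (dot_sym ((ker s)^T *m z) (phi s) symU) Uv.
  rewrite dot_trmx (dotC (ker s *m phi s)) (dotC ((ker s)^T *m z)) -mulmxA.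
  rewrite [dot z (ker s *m _)]dotC -(dot_trmx _ _ z).
  lra.
rewrite RintegralD//; last first.
  by apply: within_integrable => x; apply: cvgB; [exact: c1|exact: c2].
rewrite RintegralB// RintegralZl// Rintegral_dot// Rintegral_form// orth mul1mx.
by rewrite -/z (dotC (W *m z)); lra.
Qed.

End MatrixIntegrals.

(** * The supremum norm and the Lyapunov-Krasovskii functional *)

Section SupremumNorm.
Context {R : realType} (r : R) (nu : nat).
Hypothesis r_ge0 : 0 <= r.

Lemma segment0_in : 0 \in `[- r, 0].
Proof. by rewrite in_itv/= lexx oppr_le0 r_ge0. Qed.

Lemma norm_le_supnorm (phi : R -> 'cV[R]_nu) s : history r phi ->
  s \in `[- r, 0] -> `|phi s| <= supnorm r phi.
Proof.
move=> cphi s_in; apply: ub_le_sup; last by exists s.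
have r0 : - r <= 0 by rewrite oppr_le0.
have cn : {within `[- r, 0], continuous (fun s => `|phi s|)}.
  by move=> x; exact: cvg_norm (cphi x).
have [c _ cmax] := EVT_max r0 cn.
by exists (`|phi c|) => _ [x xin <-]; exact: cmax.
Qed.

Lemma supnorm_ge0 (phi : R -> 'cV[R]_nu) : history r phi -> 0 <= supnorm r phi.
Proof. by move=> /norm_le_supnorm/(_ segment0_in); exact: le_trans. Qed.

Lemma supnorm_le (phi : R -> 'cV[R]_nu) e :
  (forall s, s \in `[- r, 0] -> `|phi s| <= e) -> supnorm r phi <= e.
Proof.
move=> phie; apply: ge_sup; first by exists (`|phi 0|), 0 => //;
  exact: segment0_in.
by move=> _ [s s_in <-]; exact: phie.
Qed.

End SupremumNorm.

Section KrasovskiiFunctional.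
Context {R : realType} (r : R) (nu l : nat).
Notation mu := (@lebesgue_measure R).
Context (ker : R -> 'M[R]_(l, nu)).
Context (P : 'M[R]_nu) (Q : 'M[R]_(nu, l)) (Rm : 'M[R]_l) (S U : 'M[R]_nu).
Hypothesis r_gt0 : 0 < r.
Hypothesis ker_cont : {within `[- r, 0], continuous ker}.
Implicit Types g h : R -> 'cV[R]_nu.

Definition memory g : 'cV[R]_l := mxint (- r) 0 (fun s => ker s *m g s).

(** The Lyapunov-Krasovskii functional is the value of this bilinear form on the
    diagonal. The weight [s + r] vanishes at the far end of the delay interval
    and has slope one, so that the [U]-part differentiates along a trajectory
    into a term at the present time minus an integral. *)
Definition lk_form g h : R :=
  dot (g 0) (P *m h 0) + dot (g 0) (Q *m memory h) + dot (h 0) (Q *m memory g) +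
  dot (memory g) (Rm *m memory h) +
  \int[mu]_(s in `[- r, 0]) dot (g s) ((S + (s + r) *: U) *m h s).

Lemma history_linear a g h : history r g -> history r h ->
  history r (fun s => a *: g s + h s).
Proof.
move=> cg ch x; apply: cvgD; last exact: ch.
by apply: cvgZ; [exact: cvg_cst|exact: cg].
Qed.

Lemma memory_cont g : history r g ->
  {within `[- r, 0], continuous (fun s => ker s *m g s)}.
Proof. by move=> cg; exact: within_mulmx. Qed.

Lemma memory_linear a g h : history r g -> history r h ->
  memory (fun s => a *: g s + h s) = a *: memory g + memory h.
Proof.
move=> cg ch; rewrite /memory -mxint_linear; [|exact: memory_cont..].
by congr mxint; apply/funext => s; rewrite mulmxDr -scalemxAr.
Qed.

Lemma weight_cont : {within `[- r, 0], continuous (fun s => S + (s + r) *: U)}.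
Proof.
apply: continuous_subspaceT => x; apply: cvgD; first exact: cvg_cst.
apply: cvgZ; last exact: cvg_cst.
by apply: cvgD; [exact: cvg_id|exact: cvg_cst].
Qed.

Lemma lk_integrand_cont g h : history r g -> history r h ->
  {within `[- r, 0], continuous (fun s => dot (g s)
    ((S + (s + r) *: U) *m h s))}.
Proof.
move=> cg ch; apply: within_dot; first exact: cg.
by apply: within_mulmx; [exact: weight_cont|exact: ch].
Qed.

Lemma lk_form_linearl a g g' h : history r g -> history r g' -> history r h ->
  lk_form (fun s => a *: g s + g' s) h = a * lk_form g h + lk_form g' h.
Proof.
move=> cg cg' ch; rewrite /lk_form memory_linear//.
have -> : \int[mu]_(s in `[- r, 0]) dot (a *: g s + g' s)
  ((S + (s + r) *: U) *m h s)
  = a * \int[mu]_(s in `[- r, 0]) dot (g s) ((S + (s + r) *: U) *m h s) +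
    \int[mu]_(s in `[- r, 0]) dot (g' s) ((S + (s + r) *: U) *m h s).
  under eq_Rintegral do rewrite dotDl dotZl.
  have c1 := lk_integrand_cont cg ch; have c2 := lk_integrand_cont cg' ch.
  have i1 := within_integrable c1.
  rewrite RintegralD ?RintegralZl//; apply: within_integrable; last exact: c2.
  by move=> x; apply: cvgM; [exact: cvg_cst|exact: c1].
move: (Rintegral _ _ _) (Rintegral _ _ _) (memory _) (memory _) (memory _).
move: (g 0) (g' 0) (h 0) => x x' y I I' m m' n.
by rewrite !(mulmxDr, dotDl, dotDr, dotZl) -!scalemxAr !dotZr; ring.
Qed.

Lemma lk_form_linearr a g h h' : history r g -> history r h -> history r h' ->
  lk_form g (fun s => a *: h s + h' s) = a * lk_form g h + lk_form g h'.
Proof.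
move=> cg ch ch'; rewrite /lk_form memory_linear//.
have -> : \int[mu]_(s in `[- r, 0]) dot (g s)
  ((S + (s + r) *: U) *m (a *: h s + h' s))
  = a * \int[mu]_(s in `[- r, 0]) dot (g s) ((S + (s + r) *: U) *m h s) +
    \int[mu]_(s in `[- r, 0]) dot (g s) ((S + (s + r) *: U) *m h' s).
  under eq_Rintegral do rewrite mulmxDr -scalemxAr dotDr dotZr.
  have c1 := lk_integrand_cont cg ch; have c2 := lk_integrand_cont cg ch'.
  have i1 := within_integrable c1.
  rewrite RintegralD ?RintegralZl//; apply: within_integrable; last exact: c2.
  by move=> x; apply: cvgM; [exact: cvg_cst|exact: c1].
move: (Rintegral _ _ _) (Rintegral _ _ _) (memory _) (memory _) (memory _).
move: (g 0) (h 0) (h' 0) => x x' y I I' m m' n.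
by rewrite !(mulmxDr, dotDl, dotDr, dotZl) -!scalemxAr !dotZr; ring.
Qed.

Lemma within_bounded k m (X : R -> 'M[R]_(k, m)) :
  {within `[- r, 0], continuous X} ->
  exists2 c, 0 <= c & forall s, s \in `[- r, 0] -> `|X s| <= c.
Proof.
move=> cX; have r0 : - r <= 0 by rewrite oppr_le0 ltW.
have cn : {within `[- r, 0], continuous (fun s => `|X s|)}.
  by move=> x; exact: cvg_norm (cX x).
by have [c _ cmax] := EVT_max r0 cn; exists (`|X c|).
Qed.

Lemma memory_bounded :
  exists2 c, 0 <= c & forall g, history r g -> `|memory g| <= c * supnorm r g.
Proof.
have [c c0 kc] := within_bounded ker_cont.
exists (nu%:R * c * r); first by rewrite !mulr_ge0// ltW.
move=> g cg; have sg0 := supnorm_ge0 (ltW r_gt0) cg.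
apply: norm_le_coord => [|i j]; first by rewrite !mulr_ge0// ltW.
rewrite mxE.
have -> : nu%:R * c * r * supnorm r g = nu%:R * c * supnorm r g * (0 - - r).
  by rewrite sub0r opprK mulrAC.
apply: norm_Rintegral_le => [||s s_in].
- by rewrite oppr_le0 ltW.
- exact: within_coord (memory_cont cg).
- rewrite (le_trans (coord_le_norm _ _ _))// (le_trans (norm_mulmx_le _ _))//.
  by rewrite ler_pM// ?mulr_ge0// ?ler_wpM2l// ?kc// norm_le_supnorm// ltW.
Qed.

Lemma norm_form_le k m (X : 'M[R]_(k, m)) u v a b c :
  `|u| <= a -> `|X| <= b -> `|v| <= c ->
  `|dot u (X *m v)| <= k%:R * m%:R * b * (a * c).
Proof.
move=> ua Xb vc; apply: (le_trans (norm_dot_le _ _)).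
have -> : k%:R * m%:R * b * (a * c) = k%:R * (a * (m%:R * b * c)) by ring.
rewrite ler_wpM2l// ler_pM// (le_trans (norm_mulmx_le _ _))//.
by rewrite ler_pM// ?mulr_ge0// ler_wpM2l.
Qed.

Lemma lk_form_bounded : exists2 c, 0 <= c & forall g h, history r g ->
  history r h -> `|lk_form g h| <= c * (supnorm r g * supnorm r h).
Proof.
have [cm cm0 mem_le] := memory_bounded.
have [cw cw0 weight_le] := within_bounded weight_cont.
exists (nu%:R * nu%:R * `|P| + nu%:R * l%:R * `|Q| * cm +
  nu%:R * l%:R * `|Q| * cm + l%:R * l%:R * `|Rm| * (cm * cm) +
  nu%:R * nu%:R * cw * r).
  by rewrite !addr_ge0// !mulr_ge0// ltW.
move=> g h cg ch; rewrite /lk_form.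
set a := supnorm r g; set b := supnorm r h.
have r_ge0 := ltW r_gt0; have in0 := segment0_in r_ge0.
have ga : `|g 0| <= a by exact: norm_le_supnorm.
have hb : `|h 0| <= b by exact: norm_le_supnorm.
have b1 := norm_form_le ga (lexx `|P|) hb.
have b2 := norm_form_le ga (lexx `|Q|) (mem_le _ ch).
have b3 := norm_form_le hb (lexx `|Q|) (mem_le _ cg).
have b4 := norm_form_le (mem_le _ cg) (lexx `|Rm|) (mem_le _ ch).
have b5 : `|\int[mu]_(s in `[- r, 0]) dot (g s) ((S + (s + r) *: U) *m h s)| <=
    nu%:R * nu%:R * cw * (a * b) * (0 - - r).
  apply: norm_Rintegral_le => [||s s_in].
  - by rewrite oppr_le0.
  - exact: lk_integrand_cont.
  - by apply: norm_form_le;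
    [exact: norm_le_supnorm|exact: weight_le|exact: norm_le_supnorm].
rewrite -/a -/b in b1 b2 b3 b4 b5.
have -> : (nu%:R * nu%:R * `|P| + nu%:R * l%:R * `|Q| * cm +
  nu%:R * l%:R * `|Q| * cm + l%:R * l%:R * `|Rm| * (cm * cm) +
  nu%:R * nu%:R * cw * r) * (a * b) =
  nu%:R * nu%:R * `|P| * (a * b) + nu%:R * l%:R * `|Q| * (a * (cm * b)) +
  nu%:R * l%:R * `|Q| * (b * (cm * a)) +
  l%:R * l%:R * `|Rm| * ((cm * a) * (cm * b)) +
  nu%:R * nu%:R * cw * (a * b) * (0 - - r) by ring.
by do 4![apply: (le_trans (ler_normD _ _)); apply: lerD => //].
Qed.

(** A bounded quadratic functional is differentiable: the remainder of the
    expansion at [phi] is the functional itself, hence quadratically small. *)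
Lemma lk_differentiable :
  functional_differentiable r (fun phi => lk_form phi phi).
Proof.
move=> phi cphi; have [c c0 bound] := lk_form_bounded.
exists (fun h => lk_form phi h + lk_form h phi); split.
- by move=> a g h cg ch; rewrite lk_form_linearl// lk_form_linearr//; ring.
- exists (c * supnorm r phi + c * supnorm r phi) => h ch.
  rewrite (le_trans (ler_normD _ _))// mulrDl lerD//.
    by rewrite (le_trans (bound _ _ _ _))// mulrA.
  by rewrite (le_trans (bound _ _ _ _))// -mulrA (mulrC (supnorm r h)).
- move=> e e0; exists (e / (c + 1)); first by rewrite divr_gt0// ltr_wpDl.
  move=> h ch hde; have h0 := supnorm_ge0 (ltW r_gt0) ch.
  have phiE : (fun s => phi s + h s) = (fun s => 1 *: phi s + h s).
    by apply/funext => s; rewrite scale1r.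
  have hE : history r (fun s => phi s + h s).
    by rewrite phiE; exact: history_linear.
  rewrite [X in lk_form X]phiE lk_form_linearl// phiE !lk_form_linearr// !mul1r.
  have -> : lk_form phi phi + lk_form phi h + (lk_form h phi + lk_form h h) -
    lk_form phi phi - (lk_form phi h + lk_form h phi) = lk_form h h by ring.
  apply: (le_trans (bound _ _ ch ch)); rewrite mulrA ler_wpM2r//.
  move: hde; rewrite ler_pdivlMr; last by rewrite ltr_wpDl.
  by nra.
Qed.

End KrasovskiiFunctional.

(** * The functional along a trajectory *)

Section TrajectoryDerivative.
Context {R : realType} (r : R) (nu l : nat).
Notation mu := (@lebesgue_measure R).
Context (ker : R -> 'M[R]_(l, nu)) (N : 'M[R]_l).
Context (P : 'M[R]_nu) (Q : 'M[R]_(nu, l)) (Rm : 'M[R]_l) (S U : 'M[R]_nu).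
Hypothesis r_gt0 : 0 < r.
Hypothesis ker_derive : forall (s : R) i j,
  is_derive s 1 (fun x => ker x i j) ((N *m ker s) i j).

Lemma ker_continuous : continuous ker.
Proof.
move=> s; apply: cvg_mx => i j.
exact: (is_derive_continuous (fun x => ker_derive x i j)).
Qed.

Lemma segment_history (g : R -> 'cV[R]_nu) t : continuous g ->
  history r (segment g t).
Proof.
by move=> cg; apply: continuous_subspaceT => s; apply: continuous_comp;
  [apply: cvgD; [exact: cvg_cst|exact: cvg_id]|exact: cg].
Qed.

(** Because [ker] satisfies a linear differential equation with constant matrix
    [N], the integral left by the distributed delay is again a moment. *)
Lemma memory_derive (g : R -> 'cV[R]_nu) (t : R) i : continuous g ->
  is_derive t 1 (fun s => memory r ker (segment g s) i 0)
    ((ker 0 *m g t - ker (- r) *m g (t - r) -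
      N *m memory r ker (segment g t)) i 0).
Proof.
move=> cg; have ck := ker_continuous.
have cNk : continuous (fun s => N *m ker s).
  by move=> s; apply: cvg_mulmx; [exact: cvg_cst|exact: ck].
have cgj j : continuous (fun s => g s j 0) by move=> s; exact: cvg_coord (cg s).
have cgs s : continuous (fun x => g (s + x)).
  by move=> x; apply: continuous_comp;
    [apply: cvgD; [exact: cvg_cst|exact: cvg_id]|exact: cg].
have entry (K : R -> 'M[R]_(l, nu)) s : continuous K ->
    mxint (- r) 0 (fun x => K x *m g (s + x)) i 0 =
    \sum_j \int[mu]_(x in `[- r, 0]) (K x i j * g (s + x) j 0).
  move=> cK; rewrite mxE; under eq_Rintegral do rewrite mxE.
  rewrite Rintegral_sum// => j; apply: continuous_subspaceT => x.
  by apply: cvgM; [exact: cvg_coord (cK x)|exact: cvg_coord (cgs s x)].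
have -> : (fun s => memory r ker (segment g s) i 0) =
    \sum_j (fun s => \int[mu]_(x in `[- r, 0]) (ker x i j * g (s + x) j 0)).
  by apply/funext => s; rewrite fct_sumE -entry.
have -> : (ker 0 *m g t - ker (- r) *m g (t - r) -
      N *m memory r ker (segment g t)) i 0 =
    \sum_j (ker 0 i j * g t j 0 - ker (- r) i j * g (t - r) j 0 -
            \int[mu]_(x in `[- r, 0]) ((N *m ker x) i j * g (t + x) j 0)).
  rewrite 2!sumrB -entry// -mxint_mulmxl; last first.
    by apply: continuous_subspaceT => x; apply: cvg_mulmx;
      [exact: ck|exact: cgs].
  rewrite [LHS]mxE [X in _ + X]mxE [X in X + _ = _]mxE [X in _ + X + _ = _]mxE.
  rewrite [X in X - _ - _ = _]mxE [X in _ - X - _ = _]mxE; congr (_ - _ - _).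
  by rewrite !mxE; apply: eq_Rintegral => x _; rewrite mulmxA.
apply: is_derive_sum => j.
apply: (@distributed_delay_derive _ (fun x => ker x i j)
  (fun x => (N *m ker x) i j)
  (fun s => g s j 0)) => //.
by move=> s; exact: cvg_coord (cNk s).
Qed.

Lemma energy_derive (g : R -> 'cV[R]_nu) (t : R) : continuous g ->
  is_derive t 1
    (fun s => \int[mu]_(x in `[- r, 0])
       dot (g (s + x)) ((S + (x + r) *: U) *m g (s + x)))
    (dot (g t) ((S + r *: U) *m g t) - dot (g (t - r)) (S *m g (t - r)) -
     \int[mu]_(x in `[- r, 0]) dot (g (t + x)) (U *m g (t + x))).
Proof.
move=> cg; pose q X s := dot (g s) (X *m g s).
have cq X : continuous (q X).
  move=> s; apply: cvg_dot; first exact: cg.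
  by apply: cvg_mulmx; [exact: cvg_cst|exact: cg].
have cqs X s : continuous (fun x => q X (s + x)) := continuous_translate (cq X).
have i1 s : mu.-integrable `[- r, 0] (EFin \o (fun x => 1 * q S (s + x))).
  apply: continuous_integrable => x; apply: cvgM; first exact: cvg_cst.
  exact: cqs.
have i2 s : mu.-integrable `[- r, 0] (EFin \o (fun x => (x + r) * q U (s + x))).
  apply: continuous_integrable => x; apply: cvgM; last exact: cqs.
  by apply: cvgD; [exact: cvg_id|exact: cvg_cst].
have -> : (fun s => \int[mu]_(x in `[- r, 0])
      dot (g (s + x)) ((S + (x + r) *: U) *m g (s + x))) =
    (fun s => \int[mu]_(x in `[- r, 0]) (1 * q S (s + x))) +
    (fun s => \int[mu]_(x in `[- r, 0]) ((x + r) * q U (s + x))).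
  apply/funext => s; rewrite fctE -RintegralD//; apply: eq_Rintegral => x _.
  by rewrite mulmxDl -scalemxAl dotDr dotZr mul1r.
have dS : is_derive t 1 (fun s => \int[mu]_(x in `[- r, 0]) (1 * q S (s + x)))
    (1 * q S t - 1 * q S (t - r) - \int[mu]_(x in `[- r, 0]) (0 * q S (t + x))).
  apply: (@distributed_delay_derive _ (cst 1) (cst 0)) => // x.
  exact: cvg_cst.
have dU : is_derive t 1 (fun s => \int[mu]_(x in `[- r, 0])
  ((x + r) * q U (s + x)))
    ((0 + r) * q U t - (- r + r) * q U (t - r) -
     \int[mu]_(x in `[- r, 0]) (1 * q U (t + x))).
  apply: (@distributed_delay_derive _ (shift r) (cst 1)) => //.
  - by move=> x; exact: is_derive_shift.
  - by move=> x; exact: cvg_cst.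
apply: (is_derive_eq (is_deriveD dS dU)).
have -> : \int[mu]_(x in `[- r, 0]) (0 * q S (t + x)) = 0.
  by under eq_Rintegral do rewrite mul0r; rewrite Rintegral_cst// mul0r.
have -> : \int[mu]_(x in `[- r, 0]) (1 * q U (t + x)) =
    \int[mu]_(x in `[- r, 0]) dot (g (t + x)) (U *m g (t + x)).
  by apply: eq_Rintegral => x _; rewrite mul1r.
by rewrite /q mulmxDl -scalemxAl dotDr dotZr; ring.
Qed.

(** Differentiability of the trajectory is required at the time [t] only: the
    moments and the integral term are differentiable along every continuous
    trajectory. *)
Lemma lk_form_segment (g : R -> 'cV[R]_nu) (t0 t : R) g' :
  continuous g -> P^T = P -> Rm^T = Rm -> has_deriv_from t0 g t g' ->
  let z := memory r ker (segment g t) in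
  has_deriv_from t0
    (fun s => lk_form r ker P Q Rm S U (segment g s) (segment g s) : R^o) t
    (2 * dot g' (P *m g t + Q *m z) +
     2 * dot (ker 0 *m g t - ker (- r) *m g (t - r) - N *m z)
             (Q^T *m g t + Rm *m z) +
     (dot (g t) ((S + r *: U) *m g t) - dot (g (t - r)) (S *m g (t - r)) -
      \int[mu]_(x in `[- r, 0]) dot (g (t + x)) (U *m g (t + x)))).
Proof.
move=> cg P_sym R_sym dg z.
pose Z s := memory r ker (segment g s).
pose z' := ker 0 *m g t - ker (- r) *m g (t - r) - N *m z.
have dZ : has_deriv_from t0 Z t z'.
  apply: has_deriv_mx => i j; rewrite ord1.
  exact/is_derive_has_deriv_from/memory_derive.
have dP := has_deriv_dot dg (has_deriv_mulmxl (A := P) dg).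
have dQ := has_deriv_dot dg (has_deriv_mulmxl (A := Q) dZ).
have dR := has_deriv_dot dZ (has_deriv_mulmxl (A := Rm) dZ).
have dE := is_derive_has_deriv_from t0 (energy_derive t cg).
apply: (has_deriv_from_ext
  (has_derivD (has_derivD (has_derivD (has_derivD dP dQ) dQ) dR) dE)) => [s|].
  by rewrite /lk_form /segment /= !addr0.
rewrite -[Z t]/z -/z'; move: z z' {dZ dP dQ dR} => z z';
  rewrite !dotDr (dot_sym (g t) g' P_sym) (dot_sym z z' R_sym).
by rewrite (dot_mulmx Q (g t)) (dotC (Q^T *m g t)); ring.
Qed.

End TrajectoryDerivative.

(** * Continuous extensions and Lebesgue primitives *)

Section ExtensionToTheLeft.
Context {R : realType}.

(** Freezing a trajectory before the time [a] makes it continuous on the whole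
    line without changing its values after [a], so that two-sided derivatives
    and integrals of globally continuous functions become available. *)
Definition extend_left (T : Type) (a : R) (g : R -> T) : R -> T :=
  fun s => g (Num.max a s).

Lemma extend_leftE (T : Type) a (g : R -> T) s : a <= s -> extend_left a g s =
  g s.
Proof. by move=> as_; rewrite /extend_left max_r. Qed.

Lemma extend_left_continuous (T : topologicalType) (a : R) (g : R -> T) :
  {within `[a, +oo[, continuous g} -> continuous (extend_left a g).
Proof.
move=> /subspace_continuousP cg s.
have cmax : (fun x => Num.max a x) x @[x --> s] --> within `[a,
  +oo[ (nbhs (Num.max a s)).
  move=> A nA; have cm : (fun x => Num.max a x) x @[x --> s] --> Num.max a s.
    by apply: continuous_max; [exact: cvg_cst|exact: cvg_id].
  apply: (@filterS _ (nbhs s)) (cm _ nA) => x; apply.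
  by rewrite /= in_itv/= andbT le_max lexx.
apply: cvg_comp cmax _; apply: cg.
by rewrite /= in_itv/= andbT le_max lexx.
Qed.

End ExtensionToTheLeft.

Section LebesguePrimitive.
Context {R : realType}.
Notation mu := (@lebesgue_measure R).

Lemma primitive_ae_derive (h : R -> R) (t0 : R) :
  measurable_fun `[t0, +oo[ h ->
  (forall y, mu.-integrable `[t0, y] (EFin \o h)) ->
  {ae mu, forall t, t0 <= t ->
     is_derive t (1 : R) (fun y => \int[mu]_(s in `[t0, y]) h s) (h t)}.
Proof.
move=> mh ih; pose H := h \_ `[t0, +oo[.
(* starting the primitive before [t0] also covers the point [t0] *)
have HE y : `[t0 - 1, y]%classic `&` `[t0, +oo[%classic = `[t0,
  y]%classic :> set R.
  apply/seteqP; split=> x /=; rewrite !in_itv/= andbT.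
    by move=> [/andP[_ ->] ->].
  move=> /andP[t0x xy]; rewrite t0x xy andbT; split=> //.
  by rewrite lerBlDr ler_wpDr.
have iH y : mu.-integrable `[t0 - 1, y] (EFin \o H).
  rewrite /H -restrict_EFin; apply/integrable_restrict => //; rewrite HE.
  exact: ih.
have lH : locally_integrable setT H.
  split; [exact/(measurable_restrictT _ _).1|exact: openT|move=> K _ cK].
  have [M [Mreal KM]] := compact_bounded cK.
  pose B := `|M| + 1; have MB : M < B by rewrite ltr_pwDr// ler_norm.
  have KB : K `<=` `[- B, B]%classic.
    move=> x Kx; rewrite /= in_itv/= -ler_norml.
    exact: KM Kx.
  have iB : mu.-integrable `[- B, B] (EFin \o H).
    rewrite /H -restrict_EFin; apply/integrable_restrict => //.
    apply: integrableS (ih B) => //; first exact: measurableI.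
    by move=> x [] /=; rewrite !in_itv/= andbT => /andP[_ ->] ->.
  have /integrableP[_] : mu.-integrable K (EFin \o H).
    by apply: integrableS iB => //; exact: compact_measurable.
  by apply: le_lt_trans.
have := FTC1 iH lH; apply: filterS.
  exact: (ae_filter_ringOfSetsType mu).
move=> t + t0t.
case=> [|dF F']; first by rewrite lte_fin ltrBlDr ltr_pwDr.
have FE : (fun y => \int[mu]_(s in `[t0, y]) h s) =
          (fun y => \int[mu]_(s in `[t0 - 1, y]) H s).
  by apply/funext => y; rewrite -Rintegral_mkcondr HE.
rewrite FE; apply: DeriveDef; first exact: dF.
rewrite -derive1E F' /H patchE mem_set//= in_itv/= t0t //.
Qed.

(** On a bounded interval square integrability implies integrability, as
    [`|x| <= 1 + x ^+ 2]. *)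
Lemma L2_integrable q (t0 y : R) (w : R -> 'cV[R]_q) j : L2_from t0 w ->
  mu.-integrable `[t0, y] (EFin \o (fun s => w s j 0)).
Proof.
move=> /(_ j)[mw w2].
have sub : `[t0, y]%classic `<=` `[t0, +oo[%classic by exact: subset_itvl.
have mw' : measurable_fun `[t0, y] (fun s => w s j 0)
  by exact: measurable_funS mw.
have i2 : mu.-integrable `[t0, +oo[ (EFin \o (fun s => w s j 0 ^+ 2)).
  apply/integrableP; split; first exact/measurable_EFinP/measurable_funX.
  under eq_integral do rewrite /= ger0_norm ?sqr_ge0//.
  exact: w2.
have i3 : mu.-integrable `[t0, y] (EFin \o (fun s => 1 + w s j 0 ^+ 2)).
  have i1 : mu.-integrable `[t0, y] (EFin \o cst 1).
    by apply: continuous_integrable => x; exact: cvg_cst.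
  have i2' : mu.-integrable `[t0, y] (EFin \o (fun s => w s j 0 ^+ 2)).
    exact: integrableS i2.
  by have := integrableD _ i1 i2'; apply.
apply: le_integrable i3 => //; first exact/measurable_EFinP.
move=> s _ /=; rewrite lee_fin [leRHS]ger0_norm ?addr_ge0 ?sqr_ge0//.
by rewrite -real_normK ?num_real//; nra.
Qed.

End LebesguePrimitive.

(** * Points where the state equation holds *)

Section StateEquation.
Context {R : realType} (r : R) (nu l q : nat).
Notation mu := (@lebesgue_measure R).
Context (ker : R -> 'M[R]_(l, nu)) (N : 'M[R]_l).
Hypothesis r_gt0 : 0 < r.
Hypothesis ker_derive : forall (s : R) i j,
  is_derive s 1 (fun x => ker x i j) ((N *m ker s) i j).
Context (E : 'M[R]_(nu, nu + (nu + (l + q)))) (t0 : R).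
Context (w : R -> 'cV[R]_q) (eta : R -> 'cV[R]_nu).
Hypothesis sol : solution r ker E t0 w eta.

Local Notation etaX := (extend_left (t0 - r) eta).

Lemma solution_extend_continuous : continuous etaX.
Proof. by case: sol => ceta _; exact: extend_left_continuous. Qed.

Lemma solution_extendE s : t0 - r <= s -> etaX s = eta s.
Proof. exact: extend_leftE. Qed.

Lemma segment_extendE t s : t0 <= t -> s \in `[- r, 0] ->
  segment etaX t s = segment eta t s.
Proof.
move=> t0t; rewrite in_itv/= => /andP[rs _].
by rewrite /segment solution_extendE//; lra.
Qed.

Lemma memory_extendE t : t0 <= t ->
  memory r ker (segment etaX t) = memory r ker (segment eta t).
Proof.
move=> t0t; apply/matrixP => i j; rewrite !mxE.
by apply: eq_Rintegral => s /set_mem s_in; rewrite segment_extendE.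
Qed.

Lemma theta_extendE t : t0 <= t ->
  theta r ker etaX w t = theta r ker eta w t.
Proof.
move=> t0t; rewrite /theta -[mxint _ _ _]/(memory r ker (segment etaX t)).
have le1 : t0 - r <= t by rewrite lerBlDr ler_wpDr// ltW.
have le2 : t0 - r <= t - r by rewrite lerD2r.
by rewrite memory_extendE// !solution_extendE.
Qed.

(** The disturbance is the only discontinuous part of the right-hand side of the
    state equation. *)
Lemma theta_continuous_part : exists2 c : R -> 'cV[R]_nu, continuous c &
  exists E4 : 'M[R]_(nu, q), forall t,
    E *m theta r ker etaX w t = c t + E4 *m w t.
Proof.
have cX := solution_extend_continuous.
pose E1 := lsubmx E; pose E2 := lsubmx (rsubmx E).
pose E3 := lsubmx (rsubmx (rsubmx E)); pose E4 := rsubmx (rsubmx (rsubmx E)).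
have EE : E = row4 E1 E2 E3 E4 by rewrite /row4 !hsubmxK.
exists (fun t => E1 *m etaX t + (E2 *m etaX (t - r) +
                 E3 *m memory r ker (segment etaX t))).
  move=> t; apply: cvgD; [|apply: cvgD]; apply: cvg_mulmx; try exact: cvg_cst.
  - exact: cX.
  - apply: continuous_comp; last exact: cX.
    by apply: cvgB; [exact: cvg_id|exact: cvg_cst].
  - apply: cvg_mx => i j; rewrite ord1.
    exact: (is_derive_continuous (fun x => memory_derive r_gt0 ker_derive x i
      cX)).
exists E4 => t; rewrite {1}EE /theta row4_col4 -!addrA.
by [].
Qed.

Lemma solution_entry (h : R -> 'cV[R]_nu) t i : t0 <= t ->
  (forall s, E *m theta r ker etaX w s = h s) ->
  eta t i 0 = eta t0 i 0 + \int[mu]_(s in `[t0, t]) h s i 0.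
Proof.
move=> t0t hE; case: sol => _ /(_ t t0t) ->; rewrite mxE; congr (_ + _).
rewrite mxE; apply: eq_Rintegral => s; rewrite inE/= in_itv/= => /andP[t0s _].
by rewrite -theta_extendE// hE.
Qed.

Lemma state_equation_primitive t : t0 <= t ->
  (forall i, is_derive t (1 : R)
     (fun y => \int[mu]_(s in `[t0, y]) (E *m theta r ker etaX w s) i 0)
     ((E *m theta r ker etaX w t) i 0)) ->
  state_equation_at r ker E t0 w eta t.
Proof.
move=> t0t dF; rewrite /state_equation_at -theta_extendE//.
apply: has_deriv_mx => i j; rewrite ord1.
have dFi := is_derive_has_deriv_from t0 (dF i).
have := has_derivD (has_deriv_cst t0 t (eta t0 i 0 : R^o)) dFi.
rewrite add0r; apply: eq_has_deriv_from => // s t0s.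
by apply/esym; exact: (solution_entry (h :=
  fun s => E *m theta r ker etaX w s)).
Qed.

(** A solution is a primitive of an integrable function; Lebesgue's theorem
    differentiates it almost everywhere. *)
Lemma ae_state_equation : L2_from t0 w ->
  {ae mu, forall t, t0 <= t -> state_equation_at r ker E t0 w eta t}.
Proof.
move=> L2w; have [c cc [E4 thE]] := theta_continuous_part.
have entryE s i : (E *m theta r ker etaX w s) i 0 =
    c s i 0 + \sum_j E4 i j * w s j 0 by rewrite thE !mxE.
have cci i : continuous (fun s => c s i 0) by move=> s; exact: cvg_coord (cc s).
have ae_i i : {ae mu, forall t, t0 <= t -> is_derive t (1 : R)
     (fun y => \int[mu]_(s in `[t0, y]) (E *m theta r ker etaX w s) i 0)
     ((E *m theta r ker etaX w t) i 0)}.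
  apply: primitive_ae_derive.
    have -> : (fun s => (E *m theta r ker etaX w s) i 0) =
        (fun s => c s i 0 + \sum_j E4 i j * w s j 0) by exact/funext.
    apply: measurable_funD.
      by apply: measurable_funTS; exact: continuous_measurable_fun.
    apply: measurable_sum => j; apply: measurable_funM => //.
    by case: (L2w j).
  move=> y; pose wj j s := w s j 0; pose ci s := c s i 0.
  have -> : EFin \o (fun s => (E *m theta r ker etaX w s) i 0) =
    (fun s => (EFin \o ci) s + \sum_j ((E4 i j)%:E * (EFin \o wj j) s))%E.
    by apply/funext => s /=; rewrite entryE EFinD -sumEFin.
  have i1 : mu.-integrable `[t0, y] (EFin \o ci).
    exact: (continuous_integrable t0 y (cci i)).
  have i2 : mu.-integrable `[t0, y]
      (fun s => \sum_j ((E4 i j)%:E * (EFin \o wj j) s))%E.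
    apply: integrable_sum => // j _; apply: integrableZl => //.
    exact: (L2_integrable y j L2w).
  by have := integrableD _ i1 i2; apply.
have : {ae mu, forall t, forall i, t0 <= t -> is_derive t (1 : R)
     (fun y => \int[mu]_(s in `[t0, y]) (E *m theta r ker etaX w s) i 0)
     ((E *m theta r ker etaX w t) i 0)}.
  by apply: filter_forall => i; exact: ae_i.
apply: filterS; first exact: (ae_filter_ringOfSetsType mu).
by move=> t dF t0t; apply: state_equation_primitive => // i; exact: dF.
Qed.

Lemma continuous_state_equation t : continuous w -> t0 <= t ->
  state_equation_at r ker E t0 w eta t.
Proof.
move=> cw t0t; have [c cc [E4 thE]] := theta_continuous_part.
have ch : continuous (fun s => E *m theta r ker etaX w s).
  have -> : (fun s => E *m theta r ker etaX w s) = fun s => c s + E4 *m w s.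
    exact/funext.
  move=> s; apply: cvgD; first exact: cc.
  by apply: cvg_mulmx; [exact: cvg_cst|exact: cw].
rewrite /state_equation_at -theta_extendE//.
apply: has_deriv_mx => i j; rewrite ord1.
have chi : continuous (fun s => (E *m theta r ker etaX w s) i 0).
  by move=> s; exact: cvg_coord (ch s).
have [G dG] := continuous_antiderivative chi.
have := has_derivD (has_deriv_cst t0 t (eta t0 i 0 - G t0 : R^o))
  (is_derive_has_deriv_from t0 (dG t)).
rewrite add0r; apply: eq_has_deriv_from => // s t0s.
rewrite (@solution_entry (fun s => E *m theta r ker etaX w s) s)//.
rewrite (Rintegral_antiderivative t0s chi dG); ring.
Qed.

End StateEquation.

(** * Decay from a Lyapunov inequality *)

Section Decay.
Context {R : realType}.

Lemma has_deriv_from_within_continuous (t0 a b : R) (y l : R -> R) : t0 <= a ->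
  (forall t, t0 <= t -> has_deriv_from t0 (y : R -> R^o) t (l t)) ->
  {within `[a, b], continuous y}.
Proof.
move=> t0a dy; apply/subspace_continuousP => t;
  rewrite /= in_itv/= => /andP[at_ tb].
have t0t := le_trans t0a at_.
have := has_deriv_from_continuous (dy t t0t).
move=> cy A nA; have := cy A nA; rewrite /= /within /=.
apply: (@filterS _ (nbhs t)) => s yA; rewrite in_itv/= => /andP[as_ _].
have [->|st] := eqVneq s t; first exact: nbhs_singleton nA.
by apply: yA => //; rewrite in_itv/= andbT (le_trans t0a).
Qed.

Lemma has_deriv_from_MVT (t0 a b : R) (y l : R -> R) : t0 <= a -> a < b ->
  (forall t, t0 <= t -> has_deriv_from t0 (y : R -> R^o) t (l t)) ->
  exists2 c, a < c < b & y b - y a = l c * (b - a).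
Proof.
move=> t0a ab dy.
have dy' (x : R) : x \in `]a, b[ -> is_derive x 1 y (l x).
  rewrite in_itv/= => /andP[ax _]; have t0x := le_lt_trans t0a ax.
  by apply: (has_deriv_from_is_derive t0x); apply: dy; exact: ltW.
have [c] := MVT ab dy' (has_deriv_from_within_continuous t0a dy).
by rewrite in_itv/= => cab ycE; exists c.
Qed.

Lemma has_deriv_from_nincr (t0 a b : R) (y l : R -> R) : t0 <= a -> a <= b ->
  (forall t, t0 <= t -> has_deriv_from t0 (y : R -> R^o) t (l t)) ->
  (forall t, t0 <= t -> l t <= 0) -> y b <= y a.
Proof.
move=> t0a + dy l_le0; rewrite le_eqVlt => /predU1P[->//|ab].
have [c /andP[ac _] yE] := has_deriv_from_MVT t0a ab dy.
rewrite -subr_le0 yE mulr_le0_ge0 ?subr_ge0 ?(ltW ab)//.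
by rewrite l_le0// (le_trans t0a)// ltW.
Qed.

(** If [f] is not small at [t] then, its derivative being bounded, it is not
    small on an interval of fixed length after [t], along which [V] drops by a
    fixed amount; as [V] has a limit this happens only at bounded times. *)
Lemma lyapunov_decay (t0 e L : R) (V dV f df : R -> R) : 0 < e ->
  (forall t, t0 <= t -> has_deriv_from t0 (V : R -> R^o) t (dV t)) ->
  (forall t, t0 <= t -> has_deriv_from t0 (f : R -> R^o) t (df t)) ->
  (forall t, t0 <= t -> 0 <= V t) -> (forall t, t0 <= t -> 0 <= f t) ->
  (forall t, t0 <= t -> dV t <= - e * f t) ->
  (forall t, t0 <= t -> `|df t| <= L) ->
  forall d, 0 < d -> exists2 T, t0 <= T & forall t, T <= t -> f t < d.
Proof.
move=> e0 derV derf V_ge0 f_ge0 dV_le df_le d d0.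
have L0 : 0 <= L by exact: le_trans (df_le t0 (lexx _)).
have V_decr a b : t0 <= a -> a <= b -> V b <= V a.
  move=> t0a ab; apply: (has_deriv_from_nincr t0a ab derV) => t t0t.
  by rewrite (le_trans (dV_le t t0t))// mulNr oppr_le0 mulr_ge0 ?f_ge0// ltW.
pose A := [set V t | t in [set t | t0 <= t]].
have A0 : A !=set0 by exists (V t0), t0; rewrite /= ?lexx.
have Alb : has_lbound A by exists 0 => _ [t /= t0t <-]; exact: V_ge0.
(* over a time [h] the function [f] varies by at most [d / 2] *)
pose h := d / (2 * (L + 1)).
have h0 : 0 < h by rewrite divr_gt0// mulr_gt0// ltr_wpDl.
have step0 : 0 < e * h * (d / 2) by apply: mulr_gt0;
  [exact: mulr_gt0|exact: divr_gt0].
(* after [T] the functional can no longer lose [e * h * (d / 2)], so [f] falls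
   below [d / 2] somewhere in each window of length [h] *)
have [_ [T /= t0T <-] VT] : exists2 y, A y & y < inf A + e * h * (d / 2).
  exact: inf_adherent.
exists T => // t Tt; have t0t := le_trans t0T Tt.
have th : t < t + h by rewrite ltrDl.
have [c /andP[tc ch] VE] := has_deriv_from_MVT t0t th derV.
have [c' /andP[tc' cc'] fE] := has_deriv_from_MVT t0t tc derf.
have t0c : t0 <= c by rewrite (le_trans t0t)// ltW.
have t0c' : t0 <= c' by rewrite (le_trans t0t)// ltW.
have Vth : inf A <= V (t + h).
  by apply: ge_inf => //; exists (t + h) => //=; rewrite (le_trans t0t)// ltW.
have Vt : V t <= V T by exact: V_decr.
rewrite addrAC subrr add0r in VE.
have fc : f c < d / 2.
  have := dV_le c t0c; rewrite -(ltr_pM2l (mulr_gt0 e0 h0)) => dVc.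
  have : dV c * h <= - e * f c * h by rewrite ler_wpM2r// ltW.
  by lra.
have fdiff : f t - f c <= L * h.
  have : - df c' * (c - t) <= L * (c - t).
    rewrite ler_wpM2r ?subr_ge0 ?(ltW tc)//.
    by rewrite (le_trans _ (df_le c' t0c'))// -normrN ler_norm.
  have : L * (c - t) <= L * h by rewrite ler_wpM2l//; lra.
  by lra.
have : L * h <= d / 2.
  rewrite /h mulrA ler_pdivrMr ?mulr_gt0// ?ltr_wpDl//.
  by nra.
by lra.
Qed.

End Decay.

(** * Dissipativity and robust stability from a pointwise inequality *)

Lemma norm_col_mx_le (R : realType) k l (u : 'cV[R]_k) (v : 'cV[R]_l) a :
  `|u| <= a -> `|v| <= a -> `|col_mx u v| <= a.
Proof.
move=> ua va; apply: norm_le_coord; first exact: le_trans ua.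
by move=> i j; rewrite mxE; case: (fintype.split i) => o;
  apply: le_trans (coord_le_norm _ _ _) _.
Qed.

Section KrasovskiiTheorem.
Context {R : realType} (r : R) (nu l q m : nat).
Notation mu := (@lebesgue_measure R).
Context (ker : R -> 'M[R]_(l, nu)) (N WS WU : 'M[R]_l).
Context (P : 'M[R]_nu) (Q : 'M[R]_(nu, l)) (Rm : 'M[R]_l) (S U : 'M[R]_nu).
Context (J1 Jt : 'M[R]_m) (J2 : 'M[R]_(m, q)) (J3 : 'M[R]_q).
Context (sys : set ('M[R]_(nu, nu + (nu + (l + q))) *
                    'M[R]_(m, nu + (nu + (l + q))))).
Context (e : R).
Hypothesis r_gt0 : 0 < r.
Hypothesis ker_derive : forall (s : R) i j,
  is_derive s 1 (fun x => ker x i j) ((N *m ker s) i j).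
Hypothesis ker_orth : mxint (- r) 0 (fun s => ker s *m (ker s)^T) = 1%:M.
Hypothesis kerS : forall s, S *m (ker s)^T = (ker s)^T *m WS.
Hypothesis kerU : forall s, U *m (ker s)^T = (ker s)^T *m WU.
Hypotheses (P_sym : P^T = P) (R_sym : Rm^T = Rm).
Hypotheses (S_psd : possemidefmx S) (U_psd : possemidefmx U).
Hypothesis PQR_pos : posdefmx (symblock2 P Q (Rm + WS)).
Hypothesis J1_unit : J1 \in unitmx.
Hypothesis e_gt0 : 0 < e.
Hypothesis dissipation : forall E C, sys (E, C) ->
  forall (a b : 'cV[R]_nu) (z : 'cV[R]_l) (w : 'cV[R]_q) (y : 'cV[R]_m),
  2 * dot (E *m col4 a b z w) (P *m a + Q *m z) +
  2 * dot (ker 0 *m a - ker (- r) *m b - N *m z) (Q^T *m a + Rm *m z) +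
  dot a ((S + r *: U) *m a) - dot b (S *m b) - dot z (WU *m z) -
  dot w (J3 *m w) - 2 * dot (C *m col4 a b z w) (J2 *m w) +
  2 * dot y (Jt *m (C *m col4 a b z w)) + dot y (J1 *m y) <= - e * `|a| ^+ 2.

Let ker_cont : continuous ker := ker_continuous ker_derive.
Let r_ge0 : 0 <= r := ltW r_gt0.

Definition lk_functional (phi : R -> 'cV[R]_nu) : R :=
  lk_form r ker P Q Rm S U phi phi.

(** The derivative of the functional along a trajectory of velocity
    [E *m theta r ker eta w t]. *)
Definition lk_rate (E : 'M[R]_(nu, nu + (nu + (l + q)))) (w : R -> 'cV[R]_q)
    (eta : R -> 'cV[R]_nu) (t : R) : R :=
  let z := memory r ker (segment eta t) in
  2 * dot (E *m theta r ker eta w t) (P *m eta t + Q *m z) +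
  2 * dot (ker 0 *m eta t - ker (- r) *m eta (t - r) - N *m z)
          (Q^T *m eta t + Rm *m z) +
  (dot (eta t) ((S + r *: U) *m eta t) - dot (eta (t - r)) (S *m eta (t - r)) -
   \int[mu]_(x in `[- r, 0]) dot (eta (t + x)) (U *m eta (t + x))).

(** By Bessel's inequality the [S]-part of the integral pays for the term [WS]
    added to [Rm] in the positivity hypothesis. *)
Lemma lk_functional_coercive : exists2 c, 0 < c &
  forall phi, history r phi -> c * `|phi 0| ^+ 2 <= lk_functional phi.
Proof.
have [c c0 coer] := posdef_coercive PQR_pos; exists c => // phi cphi.
set z := memory r ker phi.
have energy : dot z (WS *m z) <=
    \int[mu]_(s in `[- r, 0]) dot (phi s) ((S + (s + r) *: U) *m phi s).
  have := bessel_form (continuous_subspaceT ker_cont) cphi S_psd kerS ker_orth.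
  move=> /le_trans; apply; apply: le_Rintegral => //.
  - apply: within_integrable; apply: within_dot; first exact: cphi.
    by apply: within_mulmx; [exact: within_cst|exact: cphi].
  - exact/within_integrable/lk_integrand_cont.
  - move=> s; rewrite /= in_itv/= => /andP[rs _].
    rewrite mulmxDl dotDr lerDl -scalemxAl dotZr mulr_ge0//; first by lra.
    by rewrite -quadE; case: U_psd.
have := coer (col_mx (phi 0) z); rewrite symblock2_form mulmxDl dotDr.
rewrite /lk_functional /lk_form -/z => coerz.
have : c * `|phi 0| ^+ 2 <= c * `|col_mx (phi 0) z| ^+ 2.
  by rewrite ler_pM2l// ler_sqr ?nnegrE// norm_col_mx_l.
by lra.
Qed.

Section Trajectory.
Context (E : 'M[R]_(nu, nu + (nu + (l + q)))) (t0 : R).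
Context (w : R -> 'cV[R]_q) (eta : R -> 'cV[R]_nu).
Hypothesis sol : solution r ker E t0 w eta.

Local Notation etaX := (extend_left (t0 - r) eta).
Let cX : continuous etaX := solution_extend_continuous sol.

Lemma solution_history t : t0 <= t -> history r (segment eta t).
Proof.
move=> t0t; have := segment_history (r := r) (t := t) cX.
apply: subspace_eq_continuous => s /set_mem s_in.
exact: segment_extendE.
Qed.

Lemma lk_functional_extendE t : t0 <= t ->
  lk_functional (segment etaX t) = lk_functional (segment eta t).
Proof.
move=> t0t; have in0 := segment0_in r_ge0.
rewrite /lk_functional /lk_form memory_extendE// (segment_extendE eta t0t in0).
congr (_ + _); apply: eq_Rintegral => s /set_mem s_in.
by rewrite segment_extendE.
Qed.

Lemma lk_functional_derive t : t0 <= t -> state_equation_at r ker E t0 w eta t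
  ->
  has_deriv_from t0 (fun s => lk_functional (segment eta s) : R^o) t
    (lk_rate E w eta t).
Proof.
move=> t0t eqn.
have le1 : t0 - r <= t by rewrite lerBlDr ler_wpDr.
have le2 : t0 - r <= t - r by rewrite lerD2r.
have dX : has_deriv_from t0 etaX t (E *m theta r ker eta w t).
  apply: eq_has_deriv_from eqn => // s t0s; rewrite solution_extendE//.
  by rewrite lerBlDr ler_wpDr.
have := lk_form_segment (Q := Q) (S := S) (U :=
  U) r_gt0 ker_derive cX P_sym R_sym dX.
rewrite /= memory_extendE// (solution_extendE eta le1)
  (solution_extendE eta le2) => dV.
have -> : lk_rate E w eta t = 2 * dot (E *m theta r ker eta w t)
    (P *m eta t + Q *m memory r ker (segment eta t)) +
  2 * dot (ker 0 *m eta t - ker (- r) *m eta (t - r) -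
           N *m memory r ker (segment eta t))
          (Q^T *m eta t + Rm *m memory r ker (segment eta t)) +
  (dot (eta t) ((S + r *: U) *m eta t) - dot (eta (t - r)) (S *m eta (t - r)) -
   \int[mu]_(x in `[- r, 0]) dot (etaX (t + x)) (U *m etaX (t + x))).
  congr (_ + (_ - _)); apply: eq_Rintegral => s /set_mem s_in.
  by have := segment_extendE eta t0t s_in; rewrite /segment => ->.
apply: eq_has_deriv_from dV => // s t0s.
exact: lk_functional_extendE.
Qed.

(** Bessel's inequality replaces the integral of the [U]-form by the form [WU]
    of the moments, the one in the pointwise dissipation inequality. *)
Lemma lk_rate_le C t y : sys (E, C) -> t0 <= t ->
  lk_rate E w eta t - dot (w t) (J3 *m w t) -
  2 * dot (C *m theta r ker eta w t) (J2 *m w t) +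
  2 * dot y (Jt *m (C *m theta r ker eta w t)) + dot y (J1 *m y) <=
  - e * `|eta t| ^+ 2.
Proof.
move=> EC t0t; set z := memory r ker (segment eta t).
have := bessel_form (continuous_subspaceT ker_cont) (solution_history t0t)
  U_psd kerU ker_orth.
rewrite -/z -[mxint _ _ _]/z => bessel.
have := dissipation EC (eta t) (eta (t - r)) z (w t) y.
rewrite -[col4 _ _ _ _]/(theta r ker eta w t) /lk_rate -/z.
move: bessel; rewrite /segment; lra.
Qed.

End Trajectory.

(** Completing the square in the auxiliary output [y] recovers the term of the
    supply rate that is quadratic in [z]. *)
Lemma supply_rateE z w :
  let y := - (invmx J1 *m (Jt *m z)) in
  - supply_rate Jt J1 J2 J3 z w = - dot w (J3 *m w) - 2 * dot z (J2 *m w) +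
    2 * dot y (Jt *m z) + dot y (J1 *m y).
Proof.
rewrite /supply_rate quadE symblock2_form -!mulmxA dot_trmx.
rewrite mulmxN mulKVmx// !dotNl dotNr opprK.
rewrite (dotC (invmx J1 *m _)); ring.
Qed.

Theorem krasovskii_dissipative :
  dissipative r ker sys (supply_rate Jt J1 J2 J3).
Proof.
exists lk_functional; split.
- exact: lk_differentiable r_gt0 (continuous_subspaceT ker_cont).
- move=> phi cphi; have [c c0 coer] := lk_functional_coercive.
  apply: le_trans (coer phi cphi).
  by rewrite mulr_ge0 ?exprn_ge0// ltW.
- move=> E C EC t0 w eta L2w sol dissipates_at.
  have main t : t0 <= t -> state_equation_at r ker E t0 w eta t ->
      dissipates_at t.
    move=> t0t eqn; exists (lk_rate E w eta t).
      exact: lk_functional_derive.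
    set th := theta r ker eta w t.
    rewrite supply_rateE.
    have := lk_rate_le sol (- (invmx J1 *m (Jt *m (C *m th)))) EC t0t.
    rewrite -/th !addrA => /le_trans; apply.
    by rewrite mulNr oppr_le0 mulr_ge0 ?exprn_ge0// ltW.
  split; first exact: main.
  have := ae_state_equation r_gt0 ker_derive sol L2w.
  apply: filterS; first exact: (ae_filter_ringOfSetsType mu).
  by move=> t eqn t0t; apply: main => //; exact: eqn.
Qed.

Lemma lk_functional_le : exists2 c, 0 <= c & forall phi, history r phi ->
  lk_functional phi <= c * supnorm r phi ^+ 2.
Proof.
have [c c0 bound] := lk_form_bounded P Q Rm S U r_gt0 (continuous_subspaceT
  ker_cont).
exists c => // phi cphi; apply: le_trans (ler_norm _) _.
by rewrite expr2; exact: bound.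
Qed.

Section FreeTrajectory.
Context (E : 'M[R]_(nu, nu + (nu + (l + q))))
  (C : 'M[R]_(m, nu + (nu + (l + q)))).
Context (t0 : R) (eta : R -> 'cV[R]_nu).
Hypothesis EC : sys (E, C).
Hypothesis sol : solution r ker E t0 (fun=> 0) eta.

Local Notation V t := (lk_functional (segment eta t)).
Local Notation dV t := (lk_rate E (fun=> 0) eta t).

Lemma free_state_equation t : t0 <= t ->
  state_equation_at r ker E t0 (fun=> 0) eta t.
Proof.
have c0 : continuous ((fun=> 0) : R -> 'cV[R]_q) by move=> s; exact: cvg_cst.
by move=> t0t; exact: (continuous_state_equation r_gt0 ker_derive sol).
Qed.

Lemma free_derive t : t0 <= t ->
  has_deriv_from t0 (fun s => V s : R^o) t (dV t).
Proof.
by move=> t0t; apply: lk_functional_derive => //; exact: free_state_equation.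
Qed.

(** Without disturbance, [y = 0] removes every term of the supply rate. *)
Lemma free_rate_le t : t0 <= t -> dV t <= - e * `|eta t| ^+ 2.
Proof.
move=> t0t; have := lk_rate_le sol 0 EC t0t.
by rewrite !mulmx0 !dot0l !dot0r !mulr0 !subr0 !addr0.
Qed.

Lemma free_nincr t : t0 <= t -> V t <= V t0.
Proof.
move=> t0t; apply: (has_deriv_from_nincr (lexx t0) t0t free_derive) => s t0s.
by rewrite (le_trans (free_rate_le t0s))// mulNr oppr_le0 mulr_ge0 ?exprn_ge0//
  ltW.
Qed.

Lemma free_bounded : exists2 B, 0 <= B &
  forall s, t0 - r <= s -> `|eta s| <= B.
Proof.
have [c c0 coer] := lk_functional_coercive.
have h0 := solution_history sol (lexx t0).
have s0 := supnorm_ge0 r_ge0 h0.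
have V0 : 0 <= V t0.
  by apply: le_trans (coer _ h0); rewrite mulr_ge0 ?exprn_ge0// ltW.
exists (supnorm r (segment eta t0) + (1 + V t0 / c)).
  by rewrite !addr_ge0// divr_ge0// ltW.
move=> s s_ge; have [st0|t0s] := leP s t0.
  have s_in : s - t0 \in `[- r, 0] by rewrite in_itv/=; apply/andP; split; lra.
  have := norm_le_supnorm r_ge0 h0 s_in.
  rewrite /segment addrC subrK => /le_trans; apply.
  by rewrite lerDl addr_ge0// divr_ge0// ltW.
have := coer _ (solution_history sol (ltW t0s)).
rewrite /segment addr0 => cV.
have : c * `|eta s| ^+ 2 <= V t0 by apply: le_trans cV (free_nincr (ltW t0s)).
rewrite -ler_pdivlMl// mulrC => eta2.
(* comparing [`|eta s|] with [1 + `|eta s| ^+ 2] avoids a square root *)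
have : `|eta s| <= 1 + `|eta s| ^+ 2 by nra.
by lra.
Qed.

Lemma free_derivative_bounded : exists2 B, 0 <= B &
  forall t, t0 <= t -> `|2 * dot (eta t)
    (E *m theta r ker eta (fun=> 0) t)| <= B.
Proof.
have [B B0 etaB] := free_bounded.
have [c c0 memB] := memory_bounded r_gt0 (continuous_subspaceT ker_cont).
pose K := B + (B + c * B).
have K0 : 0 <= K by rewrite !addr_ge0// mulr_ge0.
have [BK cBK] : B <= K /\ c * B <= K.
  by rewrite /K; have := mulr_ge0 c0 B0; split; lra.
pose D := nu%:R * (nu + (nu + (l + q)))%:R * `|E| * (B * K).
exists (2 * D); first by rewrite !mulr_ge0.
move=> t t0t; rewrite normrM gtr0_norm// ler_wpM2l//.
have le1 : t0 - r <= t by rewrite lerBlDr ler_wpDr.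
have le2 : t0 - r <= t - r by rewrite lerD2r.
apply: norm_form_le => //; first exact: etaB.
have memK : `|memory r ker (segment eta t)| <= K.
  apply: le_trans (memB _ (solution_history sol t0t)) _.
  apply: le_trans cBK; rewrite ler_wpM2l//; apply: supnorm_le => // s.
  rewrite in_itv/= => /andP[rs _]; apply: etaB; lra.
rewrite /theta /col4 !norm_col_mx_le// ?normr0//.
- by rewrite (le_trans (etaB _ le1)).
- by rewrite (le_trans (etaB _ le2)).
Qed.

End FreeTrajectory.

Theorem krasovskii_robustly_gas : robustly_gas r ker sys.
Proof.
have [c c0 coer] := lk_functional_coercive.
have [k k0 upper] := lk_functional_le.
move=> E C EC t0 free_solution; split.
(* the functional lies between [c * `|phi 0| ^+ 2] and [k * supnorm ^+ 2]; for
   [mn <= 1] one has [k * mn ^+ 2 <= k * mn < c] *)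
- move=> d d0; pose de := d * Num.min 1 (c / (k + 1)).
  have k1 : 0 < k + 1 by rewrite ltr_wpDl.
  have min0 : 0 < Num.min 1 (c / (k + 1)) by rewrite lt_min ltr01 divr_gt0.
  have de0 : 0 < de by rewrite mulr_gt0.
  exists de => // eta sol sup_lt t t0t.
  have h0 := solution_history sol (lexx t0).
  have := coer _ (solution_history sol t0t);
    rewrite /segment addr0 -/(segment _ _).
  move=> /le_trans/(_ (free_nincr EC sol t0t))/le_trans/(_ (upper _ h0)) bound.
  have sup2 : supnorm r (segment eta t0) ^+ 2 <= de ^+ 2.
    have s0 := supnorm_ge0 r_ge0 h0.
    by rewrite ler_sqr ?nnegrE// ltW.
  have kde : k * de ^+ 2 < c * d ^+ 2.
    rewrite /de exprMn mulrCA mulrC ltr_pM2r ?exprn_gt0//.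
    set mn := Num.min _ _ in min0 *.
    have mn1 : mn <= 1 by rewrite ge_min lexx.
    have mnc : mn * (k + 1) <= c by rewrite -ler_pdivlMr// ge_min lexx orbT.
    by nra.
  have : `|eta t| ^+ 2 < d ^+ 2.
    rewrite -(ltr_pM2l c0); apply: le_lt_trans bound (le_lt_trans _ kde).
    by rewrite ler_wpM2l.
  by rewrite ltr_sqr ?nnegrE// ltW.
- move=> eta sol; have [L L0 df_le] := free_derivative_bounded EC sol.
  pose f t := dot (eta t) (eta t).
  have f_le t : f t <= (nu%:R + 1) * `|eta t| ^+ 2.
    apply: le_trans (ler_norm _) _; apply: le_trans (norm_dot_le _ _) _.
    by rewrite -expr2 ler_wpM2r ?exprn_ge0// lerDl.
  have nu1 : 0 < nu%:R + 1 :> R by rewrite ltr_wpDl.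
  have derf t : t0 <= t -> has_deriv_from t0 (f : R -> R^o) t
      (2 * dot (eta t) (E *m theta r ker eta (fun=> 0) t)).
    move=> t0t; have eqn := free_state_equation sol t0t.
    apply: (has_deriv_from_ext (has_deriv_dot eqn eqn)) => //.
    by rewrite (dotC (E *m _)); ring.
  have V_ge0 t : t0 <= t -> 0 <= lk_functional (segment eta t).
    move=> t0t; apply: le_trans (coer _ (solution_history sol t0t)).
    by rewrite mulr_ge0 ?exprn_ge0// ltW.
  have rate t : t0 <= t ->
      lk_rate E (fun=> 0) eta t <= - (e / (nu%:R + 1)) * f t.
    move=> t0t; apply: le_trans (free_rate_le EC sol t0t) _.
    rewrite !mulNr lerN2 mulrAC ler_pdivrMr// -mulrA (mulrC _ (_ + 1)).
    by rewrite ler_pM2l.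
  have decay := lyapunov_decay (divr_gt0 e_gt0 nu1) (free_derive sol) derf V_ge0
    (fun t _ => dot_ge0 _) rate df_le.
  apply/cvgrPdist_lt => d d0.
  have [T t0T small] := decay _ (exprn_gt0 2 d0).
  have d_ge0 := ltW d0.
  near=> t; rewrite sub0r normrN -ltr_sqr ?nnegrE//.
  apply: le_lt_trans (sqr_norm_le_dot _) _; apply: small.
  by near: t; apply: nbhs_pinfty_ge; exact: num_real.
Unshelve. all: by end_near. Qed.

End KrasovskiiTheorem.

(** * Square roots of positive definite matrices *)

Section SquareRoot.
Context {R : realType}.

Lemma dot_eq0 k (u : 'cV[R]_k) : dot u u = 0 -> u = 0.
Proof.
move=> uu; apply/eqP; rewrite -normr_eq0 -sqrf_eq0 eq_le sqr_ge0 andbT -uu.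
exact: sqr_norm_le_dot.
Qed.

Lemma posdef_mulmx_tr k (X : 'M[R]_k) : X \in unitmx -> posdefmx (X^T *m X).
Proof.
move=> Xu; split=> [|x x0]; first by rewrite trmx_mul trmxK.
rewrite quadE -mulmxA dot_trmx lt_def dot_ge0 andbT.
apply: contraNneq x0 => /dot_eq0/(congr1 (mulmx (invmx X))).
by rewrite mulKmx// mulmx0 => ->.
Qed.

Lemma posdef_invmx k (X : 'M[R]_k) : posdefmx X -> posdefmx (invmx X).
Proof.
move=> Xpos; have [symX pos] := Xpos; have Xu := posdef_unitmx Xpos.
split=> [|x x0]; first by rewrite trmx_inv symX.
have := pos (invmx X *m x); rewrite !quadE mulKVmx// dotC; apply.
apply: contra x0 => /eqP/(congr1 (mulmx X)).
by rewrite mulKVmx// mulmx0 => ->.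
Qed.

Lemma interpolation (s : seq R) (g : R -> R) :
  exists p : {poly R}, forall x, x \in s -> p.[x] = g x.
Proof.
elim: s => [|a s [p pE]]; first by exists 0.
have [a_s|a_s] := boolP (a \in s).
  by exists p => x; rewrite inE => /predU1P[->|]; exact: pE.
pose q := \prod_(x <- s) ('X - x%:P).
have qa : q.[a] != 0 by rewrite -/(root q a) root_prod_XsubC.
exists (p + ((g a - p.[a]) / q.[a]) *: q) => x; rewrite inE !hornerE.
case/predU1P => [->|xs]; first by rewrite divfK// addrC subrK.
have /eqP -> : root q x by rewrite root_prod_XsubC.
by rewrite mulr0 addr0 pE.
Qed.

Lemma trmx_horner_mx k (X : 'M[R]_k.+1) (p : {poly R}) : X^T = X ->
  (horner_mx X p)^T = horner_mx X p.
Proof.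
move=> symX; elim/poly_ind: p => [|p c IHp]; first by rewrite rmorph0 trmx0.
rewrite rmorphD rmorphM /= horner_mx_X horner_mx_C linearD /= tr_scalar_mx.
congr (_ + _); rewrite -[_ * X]/(_ *m X) trmx_mul IHp symX.
by apply: (comm_mx_horner p); exact: comm_mx_refl.
Qed.

Lemma horner_mx_fix (F : fieldType) k (V : 'M[F]_k.+1)
    (d : 'rV[F]_k.+1) (p : {poly F}) :
  V \in unitmx -> (forall i, p.[d 0 i] = d 0 i) ->
  horner_mx (invmx V *m diag_mx d *m V) p = invmx V *m diag_mx d *m V.
Proof.
move=> Vu pd; rewrite horner_mx_uconjC// horner_mx_diag.
by congr (_ *m diag_mx _ *m _); apply/rowP => i; rewrite mxE.
Qed.

(** A symmetric matrix is diagonalizable with real eigenvalues, so the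
    fourth root is a polynomial in the matrix: [p] interpolating the fourth
    roots of the eigenvalues gives [Z = p X] symmetric with [Z ^+ 4 = X], and
    [Z *m Z] is positive definite as a Gram matrix. *)
Lemma posdef_sqrt_exists k (X : 'M[R]_k) : posdefmx X ->
  exists Y, posdefmx Y /\ Y *m Y = X.
Proof.
case: k X => [X Xpos|k X Xpos].
  by exists X; split=> //; apply/matrixP => -[].
have [symX pos] := Xpos; pose rc := real_complex R.
pose A := map_mx rc X.
have Aherm : A \is hermsymmx.
  apply: realsym_hermsym.
    apply/is_hermitianmxP; rewrite expr0 scale1r; apply/matrixP => i j.
    by rewrite !mxE /= -[in LHS]symX mxE.
  by apply/mxOverP => i j; rewrite mxE; apply/complex_realP; exists (X i j).
have /orthomx_spectralP AE := hermitian_normalmx Aherm.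
set V := spectralmx A in AE; set sp := spectral_diag A in AE.
have Vu : V \in unitmx := spectral_unit A.
have /mxOverP sp_real := hermitian_spectral_diag_real Aherm.
pose lam i := complex.Re (sp 0 i).
have spE i : sp 0 i = rc (lam i).
  by have /complex_realP[x spx] := sp_real 0 i; rewrite /lam -/sp in spx *;
    rewrite spx.
have lam_ge0 i : 0 <= lam i.
  have : eigenvalue A (rc (lam i)).
    apply/eigenvalueP; exists (row i V).
      by rewrite AE -row_mul !mulmxA mulmxV// mul1mx row_mul row_diag_mx
        -scalemxAl -rowE spE.
    apply: contraTneq Vu => ri; rewrite -row_free_unit -kermx_eq0.
    apply/negP => /eqP ker0.
    have : delta_mx 0 i *m V = 0 :> 'rV_k.+1 by rewrite -rowE.
    move=> /eqP; rewrite -sub_kermx ker0 submx0 => /eqP/matrixP/(_ 0 i).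
    by rewrite !mxE !eqxx => /eqP; rewrite oner_eq0.
  rewrite eigenvalue_root_char -map_char_poly fmorph_root -eigenvalue_root_char.
  move=> /eigenvalueP[v vX v0].
  have : 0 < dot v^T (X *m v^T) by rewrite -quadE pos// trmx_eq0.
  rewrite /dot trmxK mulmxA vX -scalemxAl mxE => lv.
  have : 0 <= (v *m v^T) 0 0 by have := dot_ge0 v^T; rewrite /dot trmxK.
  by rewrite le_eqVlt => /predU1P[v2|v2]; [move: lv;
    rewrite -v2 mulr0 ltxx|move: lv; rewrite pmulr_lgt0// => /ltW].
have [p pE] := interpolation [seq lam i | i : 'I_k.+1]
  (fun x => Num.sqrt (Num.sqrt x)).
have p4 i : (p ^+ 4).[lam i] = lam i.
  rewrite horner_exp pE ?map_f ?mem_enum//.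
  by rewrite -[4%N]/(2 * 2)%N exprM !sqr_sqrtr ?sqrtr_ge0.
pose Z := horner_mx X p.
have Z4 : Z ^+ 4 = X.
  have q_fix i : (map_poly rc (p ^+ 4)).[sp 0 i] = sp 0 i.
    by rewrite spE horner_map p4.
  have := horner_mx_fix Vu q_fix; rewrite -AE => A4.
  by apply: (@map_mx_inj _ _ rc); rewrite -rmorphXn /= map_horner_mx.
have symZ : Z^T = Z by exact: trmx_horner_mx.
have Zu : Z \in unitmx.
  have Xu := posdef_unitmx Xpos; rewrite -Z4 exprS in Xu.
  by move: Xu; rewrite unitmx_mul => /andP[].
exists (Z *m Z); split; first by rewrite -{1}symZ; exact: posdef_mulmx_tr.
by rewrite -[RHS]Z4 (exprD Z 2 2) expr2.
Qed.

(** With [D = Y - Z], the equality of squares reads [Y *m D = - D *m Z], so that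
    the traces of [D *m Y *m D] and [D *m Z *m D], both nonnegative, are
    opposite, hence zero. *)
Lemma posdef_sqrt_inj k (Y Z : 'M[R]_k) : posdefmx Y -> posdefmx Z ->
  Y *m Y = Z *m Z -> Y = Z.
Proof.
move=> [symY Ypos] [symZ Zpos] YZ; pose D := Y - Z.
have symD : D^T = D by rewrite linearB /= symY symZ.
have trE (X : 'M[R]_k) :
    \tr (D *m X *m D) = \sum_i dot (col i D) (X *m col i D).
  apply: eq_bigr => i _; rewrite /dot tr_col symD mulmxA -row_mul mxE [RHS]mxE.
  by apply: eq_bigr => j _; rewrite [row _ _ _ _]mxE [col _ _ _ _]mxE.
have term_ge0 (X : 'M[R]_k) : posdefmx X ->
    forall i, 0 <= dot (col i D) (X *m col i D).
  move=> /posdef_coercive[c c0 coer] i; apply: le_trans (coer _).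
  by rewrite mulr_ge0 ?exprn_ge0// ltW.
have YD : Y *m D = - (D *m Z).
  by rewrite /D mulmxBr mulmxBl YZ opprB.
have tr0 : \tr (D *m Y *m D) + \tr (D *m Z *m D) = 0.
  rewrite -[D *m Y *m D]mulmxA YD mulmxN linearN /= -[D *m Z *m D]mulmxA.
  by rewrite [\tr (D *m (D *m Z))]mxtrace_mulC -mulmxA addNr.
have trY_ge0 : 0 <= \tr (D *m Y *m D).
  by rewrite trE sumr_ge0// => i _; exact: (term_ge0 Y).
have trZ_ge0 : 0 <= \tr (D *m Z *m D).
  by rewrite trE sumr_ge0// => i _; exact: (term_ge0 Z).
have : \tr (D *m Y *m D) = 0 by lra.
rewrite trE => /psumr_eq0P col0.
have colD i : col i D = 0.
  apply/eqP/negPn/negP => /Ypos; rewrite quadE col0 ?ltxx// => j _.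
  exact: (term_ge0 Y).
apply/eqP; rewrite -subr_eq0 -/D; apply/eqP/matrixP => i j.
by have /matrixP/(_ i 0) := colD j; rewrite !mxE.
Qed.

Lemma sqrtmxP k (X : 'M[R]_k) : posdefmx X ->
  posdefmx (sqrtmx X) /\ sqrtmx X *m sqrtmx X = X.
Proof. by move=> /posdef_sqrt_exists YX; exact: (xgetPex 0 YX). Qed.

Lemma sqrtmx_invmx k (X : 'M[R]_k) : posdefmx X ->
  sqrtmx (invmx X) = invmx (sqrtmx X).
Proof.
move=> Xpos; have [sX sX2] := sqrtmxP Xpos.
have [siX siX2] := sqrtmxP (posdef_invmx Xpos).
apply: posdef_sqrt_inj => //; first exact: posdef_invmx.
have su := posdef_unitmx sX.
have Xu := posdef_unitmx Xpos.
rewrite siX2; apply: (can_inj (mulKmx Xu)); rewrite mulmxV//.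
move: (sqrtmx X) sX2 su => s <- su.
by rewrite -mulmxA mulKVmx// mulmxV.
Qed.

End SquareRoot.

(** * Kronecker kernels and the main theorem *)

Section KroneckerKernel.
Context {R : realType}.

Lemma mulmx_castr m k k' p (e : k' = k) (A : 'M[R]_(p, m)) (X : 'M[R]_(m, k')) :
  A *m castmx (erefl _, e) X = castmx (erefl _, e) (A *m X).
Proof. by case: _ / e. Qed.

Lemma mulmx_cast_tr k k' p (e : k' = k) (X Y : 'M[R]_(p, k')) :
  castmx (erefl _, e) X *m (castmx (erefl _, e) Y)^T = X *m Y^T.
Proof. by case: _ / e. Qed.

Lemma mulmx_castl k k' p (e : k' = k) (U : 'M[R]_k) (X : 'M[R]_(p, k')) :
  U *m (castmx (erefl _, e) X)^T =
  (castmx (erefl _, e) (X *m (castmx (esym e, esym e) U)^T))^T.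
Proof. by case: _ / e U => U; rewrite trmx_mul trmxK. Qed.

Lemma kronI_mulmx d k (A : 'M[R]_d) (x : 'cV[R]_d) :
  (A *t (1%:M : 'M[R]_k)) *m kronI k x = kronI k (A *m x).
Proof. by rewrite /kronI mulmx_castr tensmx_mul mulmx1. Qed.

Lemma kronI_gram d k (x y : 'cV[R]_d) :
  kronI k x *m (kronI k y)^T = (x *m y^T) *t (1%:M : 'M[R]_k).
Proof. by rewrite /kronI mulmx_cast_tr trmx_tens tensmx_mul trmx1 mulmx1. Qed.

Lemma kronI_comm d k (x : 'cV[R]_d) (U : 'M[R]_k) :
  U *m (kronI k x)^T = (kronI k x)^T *m ((1%:M : 'M[R]_d) *t U).
Proof.
rewrite /kronI mulmx_castl -[RHS]trmxK trmx_mul trmxK -tens_scalar1mx.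
by rewrite mulmx_castr !trmx_tens !tensmx_mul !trmx1 !mulmx1 !mul1mx.
Qed.

Lemma kronIE d k (x : 'cV[R]_d) i j :
  kronI k x i j = x (mxtens_unindex i).1 0 * ((mxtens_unindex i).2 == j)%:R.
Proof.
rewrite /kronI castmxE cast_ord_id !mxE [(mxtens_unindex (cast_ord _ j)).1]ord1.
by congr (_ * (_ == _)%:R); apply: val_inj; rewrite /= modn_small.
Qed.

Lemma tensmx1 d k : (1%:M : 'M[R]_d) *t (1%:M : 'M[R]_k) = 1%:M.
Proof.
apply/matrixP => i j; case: (mxtens_indexP i) => a b;
  case: (mxtens_indexP j) => c e.
rewrite tensmxE !mxE (inj_eq (can_inj (@mxtens_indexK _ _))) xpair_eqE.
by rewrite -natrM mulnb.
Qed.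

Lemma mxint_tens d k (a b : R) (X : R -> 'M[R]_d) (Y : 'M[R]_k) :
  {within `[a, b], continuous X} ->
  mxint a b (fun s => X s *t Y) = mxint a b X *t Y.
Proof.
move=> cX; apply/matrixP => i j; rewrite !mxE.
under eq_Rintegral do rewrite mxE.
rewrite RintegralZr//; apply: within_integrable.
exact: within_coord.
Qed.

Lemma kronI_derive d k (L : 'M[R]_d) (f f' : R -> 'cV[R]_d) (s : R) :
  (forall b, is_derive s (1 : R) (fun x => f x b 0) (f' s b 0)) ->
  forall i j, is_derive s (1 : R) (fun x => kronI k (L *m f x) i j)
    (kronI k (L *m f' s) i j).
Proof.
move=> df i j; rewrite kronIE.
under [X in is_derive _ _ X]eq_fun do rewrite kronIE mulrC.
rewrite mulrC; set a := (mxtens_unindex i).1; set c := _%:R.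
rewrite mxE.
have -> : (fun x => c * (L *m f x) a 0) = (c \*: (\sum_b (fun x => L a b * f x
  b 0))).
  by apply/funext => x; rewrite /= fct_sumE mxE.
by apply: is_deriveZ; apply: is_derive_sum => b.
Qed.

End KroneckerKernel.

Theorem theorem3p3 (R : realType) (n p q m d : nat) (r : R) (hr : 0 < r)
    (f : R -> 'cV[R]_d) (M : 'M[R]_d)
    (f_derivable : forall t, derivable f t 1)
    (f_C1 : continuous (derive1 f))
    (f_ode : forall t, derive1 f t = M *m f t)
    (f_gram : posdefmx (mxint (- r) 0 (fun t => f t *m (f t)^T))) :
  let nu := (n + p)%N in
  let F : 'M[R]_d := invmx (mxint (- r) 0 (fun t => f t *m (f t)^T)) in
  let ker : R -> 'M[R]_(d * nu, nu) := fun t => kronI nu (sqrtmx F *m f t) in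
  forall (A : 'M[R]_n) (B : 'M[R]_(n, p))
    (stabilizable : exists K : 'M[R]_(p, n), hurwitz (A + B *m K))
    (f_predictor : exists (K : 'M[R]_(p, n)) (X : 'M[R]_p)
         (Kh : 'M[R]_(p, d * nu)), forall t,
       row_mx (0 : 'M[R]_(p, n))
              ((K *m A - X *m K) *m expmx (- t *: A) *m B) = Kh *m ker t)
    (C1 C2 : 'M[R]_(m, nu)) (C3 : 'M[R]_(m, d * nu))
    (D1 : 'M[R]_(n, q)) (D2 : 'M[R]_(m, q)) (D3 : 'M[R]_(p, q))
    (c1 c2 : channel R nu nu) (c3 : channel R nu (d * nu))
    (c4 : channel R nu q)
    (c5 c6 : channel R m nu) (c7 : channel R m (d * nu)) (c8 : channel R m q)
    (J1 Jt : 'M[R]_m) (J2 : 'M[R]_(m, q)) (J3 : 'M[R]_q)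
    (J1_sym : J1^T = J1) (J1_unit : J1 \in unitmx)
    (J1_neg : negdefmx (invmx J1)) (J3_sym : J3^T = J3)
    (P : 'M[R]_nu) (Q : 'M[R]_(nu, d * nu)) (Rm : 'M[R]_(d * nu))
    (S U : 'M[R]_nu) (P_sym : P^T = P) (Rm_sym : Rm^T = Rm)
    (S_sym : S^T = S) (U_sym : U^T = U)
    (K1 K2 : 'M[R]_(p, nu)) (K3 : 'M[R]_(p, d * nu)) (k1 k2 : R)
    (k1_gt0 : 0 < k1) (k2_gt0 : 0 < k2),
  let bF := dsum (dsum4 (cF c1) (cF c2) (cF c3) (cF c4))
                 (dsum4 (cF c5) (cF c6) (cF c7) (cF c8)) in
  let bJ1 := dsum (dsum4 (cXi c1) (cXi c2) (cXi c3) (cXi c4))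
                  (dsum4 (cXi c5) (cXi c6) (cXi c7) (cXi c8)) in
  let bJ2 := dsum (dsum4 (cLam c1) (cLam c2) (cLam c3) (cLam c4))
                  (dsum4 (cLam c5) (cLam c6) (cLam c7) (cLam c8)) in
  let bJ3 := dsum (dsum4 (cGam c1) (cGam c2) (cGam c3) (cGam c4))
                  (dsum4 (cGam c5) (cGam c6) (cGam c7) (cGam c8)) in
  let bG := block_mx (col4 P (0 : 'M[R]_nu) Q^T (0 : 'M[R]_(q, nu)))
                     (col4 (0 : 'M[R]_(nu, m)) (0 : 'M[R]_(nu, m))
                           (0 : 'M[R]_(d * nu, m)) (- J2^T))
                     (0 : 'M[R]_(m, nu)) Jt *m
            dsum (row4 (cG c1) (cG c2) (cG c3) (cG c4))
                 (row4 (cG c5) (cG c6) (cG c7) (cG c8)) in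
  let bH := col_mx (dsum4 (cH c1) (cH c2) (cH c3) (cH c4))
                   (dsum4 (cH c5) (cH c6) (cH c7) (cH c8)) *m
            row_mx (1%:M : 'M[R]_(nu + (nu + (d * nu + q))))
                   (0 : 'M[R]_(_, m)) in
  let bP := row_mx (row4 P (0 : 'M[R]_nu) Q (0 : 'M[R]_(nu, q)))
                   (0 : 'M[R]_(nu, m)) in
  let bA := row_mx (row4 (block_mx A 0 0 0 : 'M[R]_nu)
                         (block_mx 0 B 0 0 : 'M[R]_nu)
                         (0 : 'M[R]_(nu, d * nu)) (col_mx D1 D3))
                   (0 : 'M[R]_(nu, m)) in
  let bB := col_mx (0 : 'M[R]_(n, p)) (1%:M : 'M[R]_p) in
  let bK := row_mx (row4 K1 K2 K3 (0 : 'M[R]_(p, q))) (0 : 'M[R]_(p, m)) in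
  let bPhi :=
    Sy (col_mx (col4 Q (0 : 'M[R]_(nu, d * nu)) Rm (0 : 'M[R]_(q, d * nu)))
               (0 : 'M[R]_(m, d * nu)) *m
        row_mx (row4 (ker 0) (- ker (- r))
                     (- ((sqrtmx F *m M *m sqrtmx (invmx F)) *t
                         (1%:M : 'M[R]_nu)))
                     (0 : 'M[R]_(d * nu, q)))
               (0 : 'M[R]_(d * nu, m)))
    + dsum (dsum4 (S + r *: U) (- S) (- ((1%:M : 'M[R]_d) *t U)) (- J3)) J1
    + Sy (col_mx (col4 (0 : 'M[R]_(nu, m)) (0 : 'M[R]_(nu, m))
                       (0 : 'M[R]_(d * nu, m)) (- J2^T)) Jt *m
          row_mx (row4 C1 C2 C3 D2) (0 : 'M[R]_m)) in
  posdefmx (symblock2 P Q (Rm + (1%:M : 'M[R]_d) *t S)) ->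
  possemidefmx S ->
  possemidefmx U ->
  posdefmx (symblock3 1%:M (- 1%:M - k1 *: (bF^T *m bJ2)) (k1 *: bF^T)
                      (1%:M - k1 *: bJ3) 0
                      (k1 *: bJ1)) ->
  negdefmx (symblock3 (bPhi + Sy (bP^T *m (bA + bB *m bK)))
                      (bG + k2 *: (bH^T *m bJ2)) (k2 *: bH^T)
                      (k2 *: (bF^T *m bJ2) + k2 *: (bJ2^T *m bF) + k2 *: bJ3)
                      (k2 *: bF^T)
                      (- (k2 *: bJ1))) ->
  let closed_loop := uncertain_system
    (row4 (col_mx (row_mx A 0) K1) (col_mx (row_mx 0 B) K2)
          (col_mx 0 K3) (col_mx D1 D3))
    (row4 C1 C2 C3 D2) c1 c2 c3 c4 c5 c6 c7 c8 in
  [/\ well_posed c1, well_posed c2, well_posed c3 & well_posed c4] /\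
  [/\ well_posed c5, well_posed c6, well_posed c7 & well_posed c8] /\
  dissipative r ker closed_loop (supply_rate Jt J1 J2 J3) /\
  robustly_gas r ker closed_loop.
Proof.
move=> nu F ker A B _ _ C1 C2 C3 D1 D2 D3 c1 c2 c3 c4 c5 c6 c7 c8.
move=> J1 Jt J2 J3 J1_sym J1_unit J1_neg J3_sym P Q Rm S U P_sym Rm_sym.
move=> S_sym U_sym K1 K2 K3 k1 k2 k1_gt0 k2_gt0 bF bJ1 bJ2 bJ3 bG bH bP bA bB
  bK.
move=> bPhi PQR_pos S_psd U_psd lmi_wp lmi closed_loop.
have [] := strict_on_graph_dsum (posdef_strict_on_graph k1_gt0 lmi_wp).
move=> /strict_on_graph_dsum4[s1 s2 s3 s4] /strict_on_graph_dsum4[s5 s6 s7 s8].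
have wp14 : [/\ well_posed c1, well_posed c2, well_posed c3 & well_posed c4].
  by split; exact: strict_well_posed.
have wp58 : [/\ well_posed c5, well_posed c6, well_posed c7 & well_posed c8].
  by split; exact: strict_well_posed.
split=> //; split=> //.
set gram := mxint _ _ _ in f_gram F ker bPhi lmi *.
have F_pos : posdefmx F by exact: posdef_invmx.
have gram_unit := posdef_unitmx f_gram.
have [sF_pos sF2] := sqrtmxP F_pos.
have sF_unit := posdef_unitmx sF_pos.
pose N : 'M[R]_(d * nu) :=
  (sqrtmx F *m M *m sqrtmx (invmx F)) *t (1%:M : 'M[R]_nu).
have f_entry (s : R) b : is_derive s (1 : R) (fun x => f x b 0)
  ((M *m f s) b 0).
  have dfs := f_derivable s; have dfb := (derivable_mxP _ _ _).1 dfs b 0.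
  apply: DeriveDef => //.
  by rewrite -f_ode derive1E derive_mx// mxE.
(* [f' = M *m f] becomes [ker' = N *m ker]: inserting [sqrtmx (invmx F)], the
   inverse of [sqrtmx F], expresses [f] through [sqrtmx F *m f] *)
have ker_derive (s : R) i j :
    is_derive s (1 : R) (fun x => ker x i j) ((N *m ker s) i j).
  have -> : N *m ker s = kronI nu (sqrtmx F *m (M *m f s)).
    by rewrite kronI_mulmx sqrtmx_invmx// -!mulmxA mulKmx.
  exact: (@kronI_derive _ _ _ _ f (fun s => M *m f s) _ (f_entry s)).
have f_cont : continuous f.
  move=> s; apply: cvg_mx => i j; rewrite ord1.
  exact: (is_derive_continuous (fun x => f_entry x i)).
have ff_cont : continuous (fun s => f s *m (f s)^T).
  by move=> s; apply: cvg_mulmx; [exact: f_cont|apply: cvg_trmx; exact: f_cont].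
(* the factor [sqrtmx F] normalizes the Gram matrix [invmx F] of [f] *)
have ker_orth : mxint (- r) 0 (fun s => ker s *m (ker s)^T) = 1%:M.
  have -> : (fun s => ker s *m (ker s)^T) = (fun s =>
      (sqrtmx F *m (f s *m (f s)^T) *m sqrtmx F) *t (1%:M : 'M[R]_nu)).
    apply/funext => s; rewrite kronI_gram trmx_mul; case: sF_pos => -> _.
    by rewrite !mulmxA.
  have c1' : continuous (fun s => sqrtmx F *m (f s *m (f s)^T)).
    by move=> s; apply: cvg_mulmx; [exact: cvg_cst|exact: ff_cont].
  rewrite mxint_tens; last first.
    apply: continuous_subspaceT => s.
    by apply: cvg_mulmx; [exact: c1'|exact: cvg_cst].
  rewrite mxint_mulmxr; last exact: continuous_subspaceT.
  rewrite mxint_mulmxl; last exact: continuous_subspaceT.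
  have -> : mxint (- r) 0 (fun t => f t *m (f t)^T) = invmx F
    by rewrite /F invmxK.
  have -> : sqrtmx F *m invmx F *m sqrtmx F = 1%:M.
    apply: (can_inj (mulKmx sF_unit)).
    by rewrite !mulmxA sF2 mulmxV ?posdef_unitmx// mul1mx mulmx1.
  exact: tensmx1.
have kerS s : S *m (ker s)^T = (ker s)^T *m ((1%:M : 'M[R]_d) *t S) :=
  kronI_comm _ _.
have kerU s : U *m (ker s)^T = (ker s)^T *m ((1%:M : 'M[R]_d) *t U) :=
  kronI_comm _ _.
(* the gains [K1], [K2], [K3] enter the nominal matrix through [bB *m bK] *)
have E0E : bA + bB *m bK = row_mx (row4 (col_mx (row_mx A 0) K1)
    (col_mx (row_mx 0 B) K2) (col_mx 0 K3) (col_mx D1 D3)) 0.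
  rewrite /bA /bB /bK /row4 !mul_mx_row !mulmx0 !add_row_mx !mul_col_mx.
  by rewrite !mul0mx !mul1mx /block_mx -col_mx0 !add_col_mx row_mx0 !(add0r,
    addr0).
rewrite E0E in lmi.
have [e e0 diss] := lmi_dissipation P_sym Rm_sym k2_gt0 wp14 wp58 lmi.
split.
  exact: (krasovskii_dissipative hr ker_derive ker_orth kerS kerU P_sym Rm_sym
    S_psd U_psd PQR_pos J1_unit e0 diss).
exact: (krasovskii_robustly_gas hr ker_derive ker_orth kerS kerU P_sym Rm_sym
    S_psd U_psd PQR_pos e0 diss).
Qed.
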